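(* Let $(W,S)$ be a Coxeter system, $R$ a fusion ring with basis $\mathfrak B$, and $R\Lambda_S$ a geometric $R$-realisation of $(W,S)$, with unfolded Coxeter system $(\check W,\check S)$, unfolding homomorphism $\varphi:W\to\check W$, and complexified hyperplane complements $\Omega_{\mathrm{reg}}$ and $\check\Omega_{\mathrm{reg}}$. The embedding $\Theta=\mathrm{Hom}_R(R\Lambda_S,\mathbb R)\subseteq\check\Theta=\mathrm{Hom}_{\mathbb Z}(R\Lambda_S,\mathbb R)$ induces an embedding of complexified hyperplane complements $\Omega_{\mathrm{reg}}\subseteq\check\Omega_{\mathrm{reg}}$. The induced map on fundamental groups $\tilde\varphi:\pi_1(\Omega_{\mathrm{reg}}/W)\to\pi_1(\check\Omega_{\mathrm{reg}}/\check W)$ lifts the homomorphism $\varphi$; that is, writing $p:\pi_1(\Omega_{\mathrm{reg}}/W)\twoheadrightarrow W$ and $\check p:\pi_1(\check\Omega_{\mathrm{reg}}/\check W)\twoheadrightarrow\check W$ for the canonical surjections, one has $\check p\circ\tilde\varphi=\varphi\circ p$.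
   Context: Coxeter systems: $S$ is a finite set, $(m_{s,t})_{s,t\in S}$ is a symmetric matrix with $m_{s,s}=1$ and $m_{s,t}\in\{2,3,\dots,\infty\}$ for $s\ne t$, and $W=\langle S\mid (st)^{m_{s,t}}=1 \text{ whenever } m_{s,t}<\infty\rangle$. Rings are unital and associative, not necessarily commutative. Fusion ring: a ring $R$, free as a $\mathbb Z$-module on a finite basis $\mathfrak B=\{b_1,\dots,b_n\}$ with $b_1=1$, such that every product $b_jb_k=\sum_i {}_jc_{k,i}b_i$ is non-zero with all ${}_jc_{k,i}\in\mathbb Z_{\ge0}$, together with an involution $b_j\mapsto b_j^*=b_{j^*}$ of $\mathfrak B$ whose $\mathbb Z$-linear extension $*:R\to R$ satisfies $(rs)^*=s^*r^*$, and such that the coefficient of $1$ in $b_jb_k$ is $1$ if $k=j^*$ and $0$ otherwise. $R_{\ge0}$ is the set of non-negative integral combinations of $\mathfrak B$. $\mathrm{FPdim}(b_j)$ is the largest non-negative real (Frobenius–Perron) eigenvalue of the matrix $({}_jc_{k,\ell})_{k,\ell}$; extended $\mathbb Z$-linearly, $\mathrm{FPdim}:R\to\mathbb R$ is a ring homomorphism (the unique one non-negative on $\mathfrak B$), with $\mathrm{FPdim}(b)\ge1$ for $b\in\mathfrak B$ and $\mathrm{FPdim}(r^* )=\mathrm{FPdim}(r)$. Geometric $R$-realisation: $R\Lambda_S=\bigoplus_{s\in S}R\alpha_s$ is the free left $R$-module, with a $\mathbb Z$-bilinear form $B_R:R\Lambda_S\times R\Lambda_S\to R$ such that $B_R(x\alpha_s,y\alpha_t)=y\,r_{s,t}\,x^*$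 where $r_{s,t}=B_R(\alpha_s,\alpha_t)$ and $r_{s,s}=2$, such that $s(v)=v-B_R(\alpha_s,v)\alpha_s$ ($s\in S$) induces a well-defined left $R$-linear action of $W$ on $R\Lambda_S$; and, for $s\ne t$: $-r_{s,t}\in R_{\ge0}$, $r_{t,s}=r_{s,t}^*$, $\mathrm{FPdim}(r_{s,t})=-2\cos(\pi/m_{s,t})$ if $m_{s,t}<\infty$, and $\mathrm{FPdim}(r_{s,t})\le-2$ if $m_{s,t}=\infty$. Unfolded Coxeter system $(\check W,\check S)$: $\check S=\mathfrak B\times S$. For $(b_i,s),(b_j,t)\in\check S$ define integers $\check r_{(b_i,s),(b_j,t)}$ by: $2$ if $(b_i,s)=(b_j,t)$, $0$ if $s=t$ and $i\ne j$, and for $s\neq t$ by $b_j r_{s,t}=\sum_i \check r_{(b_i,s),(b_j,t)}b_i$. Distinct vertices are joined by an edge of the Coxeter graph iff $\check r\ne0$; the label is $3$ if $\check r=-1$ and $\infty$ if $\check r\le-2$ (no edge means $m=2$). $\mathbb Z\Lambda_{\check S}=\bigoplus_{(b,s)}\mathbb Z\alpha_{b,s}$ carries the symmetric form $B_{\mathbb Z}$ with matrix $\check r$, and $\check W$ acts by $(b,s)(v)=v-B_{\mathbb Z}(\alpha_{b,s},v)\alpha_{b,s}$. $\mathbb Z\Lambda_{\check S}$ is identified with $R\Lambda_S$ via $\alpha_{b,s}\leftrightarrow b\alpha_s$, so $\check W$ acts on $R\Lambda_S$ $\mathbb Z$-linearly. The unfolding homomorphism is $\varphi:W\to\check W$,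 $s\mapsto\prod_{b\in\mathfrak B}(b,s)$ (a well-defined group homomorphism; the factors commute). Dual spaces: $\mathbb R$ is a left $R$-module via $\mathrm{FPdim}$. $\Theta=\mathrm{Hom}_R(R\Lambda_S,\mathbb R)$ and $\check\Theta=\mathrm{Hom}_{\mathbb Z}(R\Lambda_S,\mathbb R)$, with contragredient actions $(w\cdot Z)(v)=Z(w^{-1}v)$ of $W$ on $\Theta$ and of $\check W$ on $\check\Theta$. Let $C=\{Z\in\Theta: Z(\alpha_s)\ge0\ \forall s\in S\}$ and $\check C=\{Z\in\check\Theta: Z(b\alpha_s)\ge0\ \forall b\in\mathfrak B,s\in S\}$. Both actions are actions as real reflection groups in the sense of Vinberg, with (closed) fundamental chambers $C$ and $\check C$. $T=\bigcup_{w\in W}w\cdot C$, and $T^\circ$ (interior in $\Theta$) is the Tits cone; $\mathcal A$ is the set of fixed hyperplanes in $\Theta$ of the elements $wsw^{-1}$ ($w\in W$, $s\in S$). $\check T$, $\check T^\circ$ (interior in $\check\Theta$) and $\check{\mathcal A}$ are defined in the same way from $\check W$, $\check S$, $\check C$, $\check\Theta$. Complexified complements: $\Omega_{\mathrm{reg}}=(T^\circ\times T^\circ)\setminus\bigcup_{H\in\mathcal A}(H\times H)$ and $\check\Omega_{\mathrm{reg}}=(\check T^\circ\times\check T^\circ)\setminus\bigcup_{\check H\in\check{\mathcal A}}(\check H\times\check H)$, on which $W$, resp. $\check W$, acts diagonally, freely and properly discontinuously. Base points are the images of $(x_0,x_0)$ for a chosen $x_0$ in the interior $C^\circ$ of $C$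 (one has $C^\circ\subseteq\check C^\circ$). The surjection $\pi_1(\Omega_{\mathrm{reg}}/W)\to W$ sends the class of a loop to the $w\in W$ such that its lift starting at $(x_0,x_0)$ ends at $w\cdot(x_0,x_0)$; similarly for $\check W$. $\tilde\varphi$ is induced by the map of orbit spaces $\Omega_{\mathrm{reg}}/W\to\check\Omega_{\mathrm{reg}}/\check W$ coming from the inclusion $\Omega_{\mathrm{reg}}\subseteq\check\Omega_{\mathrm{reg}}$, which is $W$-equivariant with respect to $\varphi$. By Van der Lek's theorem these fundamental groups are the Artin–Tits groups of $(W,S)$ and $(\check W,\check S)$. *)

(* Defs.v *)
From HB Require Import structures.
From mathcomp Require Import all_boot all_order all_algebra.
From mathcomp Require Import all_classical all_reals all_analysis.
From mathcomp Require Import homotopy ring lra.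

Set Implicit Arguments.
Unset Strict Implicit.
Unset Printing Implicit Defensive.

Import Order.TTheory GRing.Theory Num.Theory.
Import numFieldNormedType.Exports.

Local Open Scope classical_set_scope.
Local Open Scope ring_scope.
Local Open Scope quotient_scope.

Record action (G : groupType) (X : Type) := Action {
  act :> G -> X -> X;
  act1 : forall x, act 1%g x = x;
  actM : forall g h x, act (g * h)%g x = act g (act h x)
}.

(* [None] stands for the label oo. *)
Record coxeter_matrix (S : finType) := CoxeterMatrix {
  coxm :> S -> S -> option nat;
  coxm_sym : forall s t, coxm s t = coxm t s;
  coxm_diag : forall s, coxm s s = Some 1%N;
  coxm_off : forall s t m, s != t -> coxm s t = Some m -> (2 <= m)%N
}.

Section CoxeterGroup.
Context {S : finType} (M : coxeter_matrix S).

(* The congruence on the free monoid on S generated by (st)^m = 1 whenever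
   m = m_{s,t} < oo.  As m_{s,s} = 1 it contains ss = 1, so that the quotient
   monoid is a group, with the presentation of the Coxeter group. *)
Inductive coxeter_cong : seq S -> seq S -> Prop :=
| CoxRel s t m : M s t = Some m ->
    coxeter_cong (flatten (nseq m [:: s; t])) [::]
| CoxRefl u : coxeter_cong u u
| CoxSym u v : coxeter_cong u v -> coxeter_cong v u
| CoxTrans u v w : coxeter_cong u v -> coxeter_cong v w -> coxeter_cong u w
| CoxCat u u' v v' : coxeter_cong u u' -> coxeter_cong v v' ->
    coxeter_cong (u ++ v) (u' ++ v').

Definition coxeter_eq (u v : seq S) : bool := `[< coxeter_cong u v >].

Lemma coxeter_eq_refl : reflexive coxeter_eq.
Proof. by move=> u; apply/asboolP; exact: CoxRefl. Qed.

Lemma coxeter_eq_sym : symmetric coxeter_eq.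
Proof. by move=> u v; apply/asboolP/asboolP; exact: CoxSym. Qed.

Lemma coxeter_eq_trans : transitive coxeter_eq.
Proof.
by move=> v u w /asboolP uv /asboolP vw; apply/asboolP; exact: CoxTrans uv vw.
Qed.

Canonical coxeter_equiv :=
  EquivRel coxeter_eq coxeter_eq_refl coxeter_eq_sym coxeter_eq_trans.

Definition coxeter_group : Type := {eq_quot coxeter_equiv}.

HB.instance Definition _ := Choice.on coxeter_group.

Definition coxeter_class (u : seq S) : coxeter_group := \pi_{eq_quot coxeter_equiv} u.
Definition coxeter_word (w : coxeter_group) : seq S :=
  repr (w : {eq_quot coxeter_equiv}).

Lemma coxeter_wordK : cancel coxeter_word coxeter_class.
Proof. by move=> w; rewrite /coxeter_class reprK. Qed.

Lemma coxeter_classP u v : coxeter_class u = coxeter_class v <-> coxeter_cong u v.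
Proof.
split=> [/eqmodP/asboolP //|uv]; apply/eqmodP; exact/asboolP.
Qed.

Lemma coxeter_class_word u : coxeter_cong (coxeter_word (coxeter_class u)) u.
Proof. by apply/coxeter_classP; rewrite coxeter_wordK. Qed.

Lemma coxeter_cong_ss s : coxeter_cong [:: s; s] [::].
Proof. exact: (CoxRel (coxm_diag M s)). Qed.

Lemma coxeter_cong_rev u : coxeter_cong (rev u ++ u) [::].
Proof.
elim: u => [|s u IH]; first exact: CoxRefl.
rewrite rev_cons -cats1 -catA /=.
apply: CoxTrans IH; rewrite -[X in coxeter_cong _ (_ ++ X)]cat0s.
apply: (CoxCat (CoxRefl _)).
exact: (CoxCat (coxeter_cong_ss s) (CoxRefl u)).
Qed.

Lemma coxeter_cong_revr u v : coxeter_cong u v -> coxeter_cong (rev u) (rev v).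
Proof.
move=> uv; rewrite -[rev v]cats0 -[rev u]cat0s.
apply: CoxTrans (_ : coxeter_cong (rev v ++ u ++ rev u) _); last first.
  apply: (CoxCat (CoxRefl _)).
  by rewrite -{1}[u]revK; exact: coxeter_cong_rev.
rewrite catA; apply: CoxCat (CoxRefl _); apply: CoxSym.
apply: CoxTrans (coxeter_cong_rev v); exact: (CoxCat (CoxRefl _) uv).
Qed.

Definition coxeter_mul v w := coxeter_class (coxeter_word v ++ coxeter_word w).
Definition coxeter_one := coxeter_class [::].
Definition coxeter_inv w := coxeter_class (rev (coxeter_word w)).

Lemma coxeter_mulE u v :
  coxeter_mul (coxeter_class u) (coxeter_class v) = coxeter_class (u ++ v).
Proof. by apply/coxeter_classP; apply: CoxCat; exact: coxeter_class_word. Qed.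

Lemma coxeter_mulA : associative coxeter_mul.
Proof.
move=> u v w; rewrite -[u]coxeter_wordK -[v]coxeter_wordK -[w]coxeter_wordK.
by rewrite !coxeter_mulE catA.
Qed.

Lemma coxeter_mul1 : left_id coxeter_one coxeter_mul.
Proof. by move=> u; rewrite -[u]coxeter_wordK coxeter_mulE. Qed.

Lemma coxeter_mulr1 : right_id coxeter_one coxeter_mul.
Proof. by move=> u; rewrite -[u]coxeter_wordK coxeter_mulE cats0. Qed.

Lemma coxeter_mulV : left_inverse coxeter_one coxeter_inv coxeter_mul.
Proof.
move=> u; rewrite -{2}[u]coxeter_wordK coxeter_mulE.
by apply/coxeter_classP; exact: coxeter_cong_rev.
Qed.

Lemma coxeter_mulrV : right_inverse coxeter_one coxeter_inv coxeter_mul.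
Proof.
move=> u; rewrite -{1}[u]coxeter_wordK coxeter_mulE.
apply/coxeter_classP; rewrite -{1}[coxeter_word u]revK; exact: coxeter_cong_rev.
Qed.

HB.instance Definition _ := isGroup.Build coxeter_group coxeter_mulA
  coxeter_mul1 coxeter_mulr1 coxeter_mulV coxeter_mulrV.

Definition coxeter_gen (s : S) : coxeter_group := coxeter_class [:: s].

(* The homomorphism out of the Coxeter group with given values f on the
   generators, whenever f satisfies the defining relations; it is evaluated on
   some word that represents the element. *)
Definition coxeter_lift (H : groupType) (f : S -> H) (w : coxeter_group) : H :=
  (\prod_(s <- coxeter_word w) f s)%g.

Definition coxeter_rels (X : Type) (f : S -> X -> X) :=
  forall s t m, M s t = Some m -> iter m (f s \o f t) =1 id.

Section Lift.
Context (X : Type) (f : S -> X -> X) (frel : coxeter_rels f).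

Definition coxeter_act (w : coxeter_group) (x : X) := foldr f x (coxeter_word w).

Lemma foldr_coxeter_cong u v x : coxeter_cong u v -> foldr f x u = foldr f x v.
Proof.
move=> uv; elim: uv x => {u v} [s t m stm|//|u v _ IH|u v w _ IH1 _ IH2|
    u u' v v' _ IH1 _ IH2] x.
- rewrite -[RHS](frel stm); elim: m {stm} => //= m IH.
  by rewrite IH.
- by rewrite IH.
- by rewrite IH1.
- by rewrite !foldr_cat IH2 IH1.
Qed.

Lemma coxeter_act1 x : coxeter_act 1%g x = x.
Proof. exact: (foldr_coxeter_cong x (coxeter_class_word [::])). Qed.

Lemma coxeter_actM g h x :
  coxeter_act (g * h)%g x = coxeter_act g (coxeter_act h x).
Proof.
rewrite /coxeter_act -foldr_cat; apply: foldr_coxeter_cong.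
exact: coxeter_class_word.
Qed.

Definition coxeter_action : action coxeter_group X :=
  Action coxeter_act1 coxeter_actM.

Lemma coxeter_action_gen s : coxeter_action (coxeter_gen s) =1 f s.
Proof. move=> x; exact: (foldr_coxeter_cong x (coxeter_class_word [:: s])). Qed.

End Lift.
End CoxeterGroup.

Section UnitInterval.
Context (RR : realType).

Definition unit_interval : Type := set_type (`[0, 1]%classic : set RR).

HB.instance Definition _ := Topological.on unit_interval.

Lemma unit_interval0 : (0 : RR) \in `[0, 1]%classic.
Proof. by rewrite inE /= in_itv /= lexx ler01. Qed.

Lemma unit_interval1 : (1 : RR) \in `[0, 1]%classic.
Proof. by rewrite inE /= in_itv /= lexx ler01. Qed.

Lemma unit_interval_neq :
  (exist _ 0 unit_interval0 : unit_interval) != exist _ 1 unit_interval1.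
Proof. by apply/eqP => /(congr1 val) /= /eqP; rewrite eq_sym oner_eq0. Qed.

HB.instance Definition _ := isBiPointed.Build unit_interval unit_interval_neq.
End UnitInterval.

Section Homotopy.
Context {RR : realType} {X : topologicalType}.
Local Notation I := (unit_interval RR).

Definition homotopic (x y : X) (p q : {path I from x to y}) : Prop :=
  exists H : I * I -> X, [/\ continuous H,
    forall t, H (zero, t) = p t, forall t, H (one, t) = q t,
    forall s, H (s, zero) = x & forall s, H (s, one) = y].

Lemma clampP (t : RR) : (Num.max 0 (Num.min 1 t)) \in (`[0, 1]%classic : set RR).
Proof.
by rewrite inE /= in_itv /= le_max lexx /= ge_max ler01 /= ge_min lexx.
Qed.

Definition clamp (t : RR) : I :=
  exist _ (Num.max 0 (Num.min 1 t)) (clampP t).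

Lemma clamp_val (t : I) : clamp (val t) = t.
Proof.
apply: val_inj => /=; case: t => t /=; rewrite inE /= in_itv /= => /andP[t0 t1].
by rewrite min_r// max_r.
Qed.

Lemma clamp_le0 t : t <= 0 -> clamp t = zero.
Proof.
move=> t0; apply: val_inj => /=; rewrite min_r ?max_l //.
exact: le_trans t0 ler01.
Qed.

Lemma clamp_ge1 t : 1 <= t -> clamp t = one.
Proof. by move=> t1; apply: val_inj => /=; rewrite min_l // max_r. Qed.

Lemma clamp_continuous : continuous clamp.
Proof.
apply: (@continuous_comp_initial _ _ _ (set_val : I -> RR)).
have -> : set_val \o clamp = fun t : RR => Num.max 0 (Num.min 1 t).
  by apply/funext => t; rewrite /= set_valE.
move=> t; apply: continuous_max; first exact: cst_continuous.
by apply: continuous_min; [exact: cst_continuous|exact: id].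
Qed.

Lemma val_continuous : continuous (val : I -> RR).
Proof. rewrite -set_valE; exact: (@initial_continuous I RR set_val). Qed.

Lemma continuous_pasting (T : topologicalType) (f g : T -> X) (h : T -> RR) c :
  continuous f -> continuous g -> continuous h ->
  (forall z, h z = c -> f z = g z) ->
  continuous (fun z => if h z <= c then f z else g z).
Proof.
move=> cf cg ch fg; apply/continuous_subspace_setT.
have -> : [set: T] = (h @^-1` [set x | x <= c]) `|` (h @^-1` [set x | c <= x]).
  by apply/seteqP; split => // z _ /=; case: (leP (h z) c) => [|/ltW]; [left|right].
apply: withinU_continuous.
- by apply: closed_comp; [move=> z _; exact: ch|exact: closed_le].
- by apply: closed_comp; [move=> z _; exact: ch|exact: closed_ge].
- apply: (@subspace_eq_continuous _ _ _ f); last exact: continuous_subspaceT.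
  by move=> z /set_mem /= hz; rewrite /from_subspace hz.
- apply: (@subspace_eq_continuous _ _ _ g); last exact: continuous_subspaceT.
  move=> z /set_mem /= hz; rewrite /from_subspace; case: ifPn => // hz'; apply/esym/fg.
  by apply/eqP; rewrite eq_le hz hz'.
Qed.

(* Paths are extended to RR by their end points. *)
Definition extp (x y : X) (p : {path I from x to y}) (t : RR) : X := p (clamp t).
Arguments extp : simpl never.

Lemma extp_continuous x y (p : {path I from x to y}) : continuous (extp p).
Proof.
move=> t; apply: (@continuous_comp _ _ _ clamp p); first exact: clamp_continuous.
exact: cts_fun.
Qed.

Lemma extp_le0 x y (p : {path I from x to y}) t : t <= 0 -> extp p t = x.
Proof. by move=> t0; rewrite /extp clamp_le0// path_zero. Qed.

Lemma extp_ge1 x y (p : {path I from x to y}) t : 1 <= t -> extp p t = y.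
Proof. by move=> t1; rewrite /extp clamp_ge1// path_one. Qed.

Lemma extp_val x y (p : {path I from x to y}) t : extp p (val t) = p t.
Proof. by rewrite /extp clamp_val. Qed.

Lemma val_zero : val (zero : I) = 0. Proof. by []. Qed.
Lemma val_one : val (one : I) = 1. Proof. by []. Qed.

Lemma continuous_pair (T U V : topologicalType) (f : T -> U) (g : T -> V) :
  continuous f -> continuous g -> continuous (fun z => (f z, g z)).
Proof. by move=> cf cg z; apply: cvg_pair; [exact: cf|exact: cg]. Qed.

Lemma fst_cts (U V : topologicalType) : continuous (@fst U V).
Proof. by move=> z; exact: cvg_fst. Qed.

Lemma snd_cts (U V : topologicalType) : continuous (@snd U V).
Proof. by move=> z; exact: cvg_snd. Qed.

Lemma comp_cts (U V W : topologicalType) (f : U -> V) (g : V -> W) :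
  continuous f -> continuous g -> continuous (fun z => g (f z)).
Proof. by move=> cf cg z; apply: continuous_comp; [exact: cf|exact: cg]. Qed.

Lemma homotopicP x y (p q : {path I from x to y}) :
  homotopic p q <-> exists K : RR * RR -> X, [/\ continuous K,
    forall t, K (0, t) = extp p t, forall t, K (1, t) = extp q t,
    forall s, K (s, 0) = x & forall s, K (s, 1) = y].
Proof.
split=> [[H [cH H0 H1 Hx Hy]]|[K [cK K0 K1 Kx Ky]]].
  exists (fun z => H (clamp z.1, clamp z.2)); split=> [z|t|t|s|s] /=.
  - move: z; apply: comp_cts cH; apply: continuous_pair.
      exact: comp_cts (@fst_cts _ _) clamp_continuous.
    exact: comp_cts (@snd_cts _ _) clamp_continuous.
  - by rewrite clamp_le0// H0.
  - by rewrite clamp_ge1// H1.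
  - by rewrite (clamp_le0 (lexx 0)) Hx.
  - by rewrite (clamp_ge1 (lexx 1)) Hy.
exists (fun z => K (val z.1, val z.2)); split=> [z|t|t|s|s] /=.
- move: z; apply: comp_cts cK; apply: continuous_pair.
    exact: comp_cts (@fst_cts _ _) val_continuous.
  exact: comp_cts (@snd_cts _ _) val_continuous.
- by rewrite K0 extp_val.
- by rewrite K1 extp_val.
- exact: Kx.
- exact: Ky.
Qed.

Lemma homotopic_refl x y (p : {path I from x to y}) : homotopic p p.
Proof.
apply/homotopicP; exists (fun z => extp p z.2); split=> //= [|s|s].
- exact: comp_cts (@snd_cts _ _) (@extp_continuous _ _ p).
- by rewrite extp_le0.
- by rewrite extp_ge1.
Qed.

Lemma opp_cts : continuous (fun s : RR => 1 - s).
Proof. by move=> s; apply: cvgB; [exact: cvg_cst|exact: cvg_id]. Qed.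

Lemma dbl_cts (a b : RR) : continuous (fun s : RR => a * s + b).
Proof.
move=> s; apply: cvgD; last exact: cvg_cst.
by apply: cvgM; [exact: cvg_cst|exact: cvg_id].
Qed.

Lemma homotopic_sym x y (p q : {path I from x to y}) :
  homotopic p q -> homotopic q p.
Proof.
move=> /homotopicP[K [cK K0 K1 Kx Ky]]; apply/homotopicP.
exists (fun z => K (1 - z.1, z.2)); split=> [|t|t|s|s] /=.
- apply: comp_cts cK; apply: continuous_pair; last exact: snd_cts.
  exact: comp_cts (@fst_cts _ _) opp_cts.
- by rewrite subr0 K1.
- by rewrite subrr K0.
- exact: Kx.
- exact: Ky.
Qed.

Lemma homotopic_trans x y (p q r : {path I from x to y}) :
  homotopic p q -> homotopic q r -> homotopic p r.
Proof.
move=> /homotopicP[K [cK K0 K1 Kx Ky]] /homotopicP[L [cL L0 L1 Lx Ly]].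
apply/homotopicP.
exists (fun z => if z.1 <= 2^-1 then K (2 * z.1 + 0, z.2)
                 else L (2 * z.1 + -1, z.2)); split=> [|t|t|s|s] /=.
- apply: (@continuous_pasting (RR * RR)%type (fun z => K (2 * z.1 + 0, z.2))
    (fun z => L (2 * z.1 + -1, z.2)) fst 2^-1).
  + apply: comp_cts cK; apply: continuous_pair; last exact: snd_cts.
    exact: (@comp_cts _ _ _ fst _ (@fst_cts RR RR) (@dbl_cts 2 0)).
  + apply: comp_cts cL; apply: continuous_pair; last exact: snd_cts.
    exact: (@comp_cts _ _ _ fst _ (@fst_cts RR RR) (@dbl_cts 2 (-1))).
  + exact: fst_cts.
  + move=> z ->; rewrite divff// addr0 subrr K1 L0 //.
- rewrite invr_ge0 ler0n mulr0 add0r; exact: K0.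
- rewrite leNgt invf_lt1 ?ltr1n //= mulr1.
  by have -> : 2 + -1 = 1 :> RR by lra.
- by case: ifP.
- by case: ifP.
Qed.

(* Concatenation: p first, then q. *)
Section Concat.
Context {x y z : X} (p : {path I from x to y}) (q : {path I from y to z}).

Definition catp_ext (t : RR) : X :=
  if t <= 2^-1 then extp p (2 * t) else extp q (2 * t - 1).

Lemma catp_ext_cts : continuous catp_ext.
Proof.
apply: (@continuous_pasting RR (fun t => extp p (2 * t))
  (fun t => extp q (2 * t - 1)) id 2^-1) => [|||t ->].
- apply: comp_cts (@extp_continuous _ _ p) => t.
  by apply: cvgM; [exact: cvg_cst|exact: cvg_id].
- exact: comp_cts (@dbl_cts 2 (-1)) (@extp_continuous _ _ q).
- by move=> t; exact: cvg_id.
- by rewrite divff// subrr extp_ge1// extp_le0.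
Qed.

Definition catp_fun (t : I) : X := catp_ext (val t).

Lemma catp_cts : continuous catp_fun.
Proof. exact: comp_cts val_continuous catp_ext_cts. Qed.

Lemma catp0 : catp_fun zero = x.
Proof.
by rewrite /catp_fun /catp_ext val_zero invr_ge0 ler0n mulr0 extp_le0.
Qed.

Lemma catp1 : catp_fun one = z.
Proof.
rewrite /catp_fun /catp_ext val_one leNgt invf_lt1 ?ltr1n //= extp_ge1//.
by rewrite mulr1; lra.
Qed.

Definition catp : {path I from x to z} := mk_path catp_cts catp0 catp1.

Lemma extp_catp t : extp catp t = catp_ext t.
Proof.
rewrite {1}/extp /= /mk_path /catp_fun /= /catp_ext.
case: (leP t 0) => t0.
  rewrite max_l ?ge_min ?t0 ?orbT// invr_ge0 ler0n mulr0.
  have -> : t <= 2^-1 by apply: le_trans t0 _; rewrite invr_ge0.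
  by rewrite !extp_le0//; lra.
case: (leP 1 t) => t1.
  rewrite max_r // leNgt invf_lt1 ?ltr1n //=.
  have -> : (t <= 2^-1) = false.
    by apply/negbTE; rewrite -ltNge; apply: lt_le_trans t1; rewrite invf_lt1 ?ltr1n.
  by rewrite !extp_ge1//; lra.
by rewrite max_r // ltW.
Qed.
End Concat.

Lemma homotopic_catp x y z (p p' : {path I from x to y})
    (q q' : {path I from y to z}) :
  homotopic p p' -> homotopic q q' -> homotopic (catp p q) (catp p' q').
Proof.
move=> /homotopicP[K [cK K0 K1 Kx Ky]] /homotopicP[L [cL L0 L1 Lx Ly]].
apply/homotopicP.
exists (fun z => if z.2 <= 2^-1 then K (z.1, 2 * z.2 + 0)
                 else L (z.1, 2 * z.2 + -1)); split=> [|t|t|s|s] /=.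
- apply: (@continuous_pasting (RR * RR)%type (fun z => K (z.1, 2 * z.2 + 0))
    (fun z => L (z.1, 2 * z.2 + -1)) snd 2^-1).
  + apply: comp_cts cK; apply: continuous_pair; first exact: fst_cts.
    exact: (@comp_cts _ _ _ snd _ (@snd_cts RR RR) (@dbl_cts 2 0)).
  + apply: comp_cts cL; apply: continuous_pair; first exact: fst_cts.
    exact: (@comp_cts _ _ _ snd _ (@snd_cts RR RR) (@dbl_cts 2 (-1))).
  + exact: snd_cts.
  + move=> w ->; rewrite divff// addr0 subrr Ky Lx //.
- by rewrite extp_catp /catp_ext K0 L0 addr0.
- by rewrite extp_catp /catp_ext K1 L1 addr0.
- by rewrite invr_ge0 ler0n mulr0 addr0 Kx.
- rewrite leNgt invf_lt1 ?ltr1n //= mulr1.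
  by have -> : 2 + -1 = 1 :> RR by lra.
Qed.

Lemma max_cts (f g : RR -> RR) : continuous f -> continuous g ->
  continuous (fun t => Num.max (f t) (g t)).
Proof. by move=> cf cg t; apply: (@continuous_max _ _ f g t (cf t) (cg t)). Qed.

Lemma min_cts (f g : RR -> RR) : continuous f -> continuous g ->
  continuous (fun t => Num.min (f t) (g t)).
Proof. by move=> cf cg t; apply: (@continuous_min _ _ f g t (cf t) (cg t)). Qed.

Lemma homotopic_reparam x y (p q : {path I from x to y}) (f : RR -> X)
    (u v : RR -> RR) :
  continuous f -> continuous u -> continuous v ->
  (forall t, extp p t = f (u t)) -> (forall t, extp q t = f (v t)) ->
  (forall s, f ((1 - s) * u 0 + s * v 0) = x) ->
  (forall s, f ((1 - s) * u 1 + s * v 1) = y) ->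
  homotopic p q.
Proof.
move=> cf cu cv pE qE fx fy; apply/homotopicP.
exists (fun z => f ((1 - z.1) * u z.2 + z.1 * v z.2)); split=> [|t|t|s|s] //=.
- apply: (comp_cts _ cf) => z; apply: cvgD; apply: cvgM.
  + exact: (@comp_cts _ _ _ fst _ (@fst_cts RR RR) opp_cts).
  + exact: (@comp_cts _ _ _ snd _ (@snd_cts RR RR) cu).
  + exact: fst_cts.
  + exact: (@comp_cts _ _ _ snd _ (@snd_cts RR RR) cv).
- by rewrite subr0 mul1r mul0r addr0 pE.
- by rewrite subrr mul0r mul1r add0r qE.
Qed.

Definition cstp (x : X) : {path I from x to x} := cst x.

Lemma extp_cst x t : extp (cstp x) t = x. Proof. by []. Qed.

Lemma homotopic_cat1p x y (p : {path I from x to y}) :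
  homotopic (catp (cstp x) p) p.
Proof.
apply: (@homotopic_reparam _ _ _ _ (extp p)
  (fun t => Num.max (0 * t + 0) (2 * t + -1)) id).
- exact: extp_continuous.
- by apply: max_cts; exact: dbl_cts.
- by move=> t; exact: cvg_id.
- move=> t; rewrite extp_catp /catp_ext; case: ifPn => t2.
    by rewrite max_l; [rewrite extp_cst extp_le0//; lra|lra].
  by rewrite max_r //; lra.
- by [].
- by move=> s; rewrite max_l; [rewrite extp_le0//; lra|lra].
- by move=> s; rewrite max_r; [rewrite extp_ge1//; lra|lra].
Qed.

Lemma homotopic_catp1 x y (p : {path I from x to y}) :
  homotopic (catp p (cstp y)) p.
Proof.
apply: (@homotopic_reparam _ _ _ _ (extp p)
  (fun t => Num.min (2 * t + 0) (0 * t + 1)) id).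
- exact: extp_continuous.
- by apply: min_cts; exact: dbl_cts.
- by move=> t; exact: cvg_id.
- move=> t; rewrite extp_catp /catp_ext; case: ifPn => t2.
    by rewrite min_l ?addr0//; lra.
  by rewrite min_r; [rewrite extp_cst extp_ge1//; lra|lra].
- by [].
- by move=> s; rewrite min_l; [rewrite extp_le0//; lra|lra].
- by move=> s; rewrite min_r; [rewrite extp_ge1//; lra|lra].
Qed.

Definition revp_fun x y (p : {path I from x to y}) (t : I) : X :=
  extp p (1 - val t).

Section Rev.
Context {x y : X} (p : {path I from x to y}).

Lemma revp_cts : continuous (revp_fun p).
Proof.
exact: comp_cts val_continuous (comp_cts opp_cts (@extp_continuous _ _ p)).
Qed.

Lemma revp0 : revp_fun p zero = y.
Proof. by rewrite /revp_fun val_zero subr0 extp_ge1. Qed.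

Lemma revp1 : revp_fun p one = x.
Proof. by rewrite /revp_fun val_one subrr extp_le0. Qed.

Definition revp : {path I from y to x} := mk_path revp_cts revp0 revp1.

Lemma extp_revp t : extp revp t = extp p (1 - t).
Proof.
rewrite {1}/extp /= /mk_path /revp_fun /=.
case: (leP t 0) => t0.
  by rewrite max_l ?ge_min ?t0 ?orbT// !extp_ge1//; lra.
case: (leP 1 t) => t1; first by rewrite max_r // !extp_le0//; lra.
by rewrite max_r // ltW.
Qed.
End Rev.

Lemma homotopic_catpV x y (p : {path I from x to y}) :
  homotopic (catp p (revp p)) (cstp x).
Proof.
apply: (@homotopic_reparam _ _ _ _ (extp p)
  (fun t => Num.min (2 * t + 0) (-2 * t + 2)) (fun=> 0)).
- exact: extp_continuous.
- by apply: min_cts; exact: dbl_cts.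
- exact: cst_continuous.
- move=> t; rewrite extp_catp /catp_ext extp_revp; case: ifPn => t2.
    by rewrite min_l; [congr (extp p _); lra|lra].
  by rewrite min_r; [congr (extp p _); lra|lra].
- by move=> t; rewrite (extp_le0 p).
- by move=> s; rewrite min_l; [rewrite extp_le0//; lra|lra].
- by move=> s; rewrite min_r; [rewrite extp_le0//; lra|lra].
Qed.

Lemma homotopic_catVp x y (p : {path I from x to y}) :
  homotopic (catp (revp p) p) (cstp y).
Proof.
apply: (@homotopic_reparam _ _ _ _ (extp p)
  (fun t => Num.max (-2 * t + 1) (2 * t + -1)) (fun=> 1)).
- exact: extp_continuous.
- by apply: max_cts; exact: dbl_cts.
- exact: cst_continuous.
- move=> t; rewrite extp_catp /catp_ext extp_revp; case: ifPn => t2.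
    by rewrite max_l; [congr (extp p _); lra|lra].
  by rewrite max_r; [congr (extp p _); lra|lra].
- by move=> t; rewrite (extp_ge1 p).
- by move=> s; rewrite max_l; [rewrite extp_ge1//; lra|lra].
- by move=> s; rewrite max_r; [rewrite extp_ge1//; lra|lra].
Qed.

Lemma homotopic_catpA x y z w (p : {path I from x to y})
    (q : {path I from y to z}) (r : {path I from z to w}) :
  homotopic (catp (catp p q) r) (catp p (catp q r)).
Proof.
pose g (t : RR) := if t <= 2 then extp q (1 * t + -1) else extp r (1 * t + -2).
have cg : continuous g.
  apply: (@continuous_pasting RR (fun t => extp q (1 * t + -1))
    (fun t => extp r (1 * t + -2)) id 2) => [|||t ->].
  - exact: comp_cts (@dbl_cts 1 (-1)) (@extp_continuous _ _ q).
  - exact: comp_cts (@dbl_cts 1 (-2)) (@extp_continuous _ _ r).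
  - by move=> t; exact: cvg_id.
  - by rewrite extp_ge1 ?extp_le0//; lra.
pose f (t : RR) := if t <= 1 then extp p t else g t.
have cf : continuous f.
  apply: (@continuous_pasting RR (extp p) g id 1) => //.
  - exact: extp_continuous.
  - by move=> t; exact: cvg_id.
  - move=> t ->; rewrite /g ifT; last by lra.
    by rewrite extp_ge1 ?extp_le0//; lra.
have f0 (t : RR) : t <= 0 -> f t = x.
  by move=> t0; rewrite /f ifT ?extp_le0//; lra.
have f3 (t : RR) : 3 <= t -> f t = w.
  move=> t3; rewrite /f /g ifF; last by lra.
  rewrite ifF; last by lra.
  by rewrite extp_ge1//; lra.
apply: (@homotopic_reparam _ _ _ _ f
  (fun t => Num.min (4 * t + 0) (2 * t + 1))
  (fun t => Num.max (2 * t + 0) (4 * t + -1))).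
- exact: cf.
- by apply: min_cts; exact: dbl_cts.
- by apply: max_cts; exact: dbl_cts.
- move=> t; rewrite extp_catp /catp_ext extp_catp /catp_ext.
  case: ifPn => t2.
    rewrite min_l; last by lra.
    rewrite /f /g; case: ifPn => t4.
      by rewrite ifT; [congr extp; lra|lra].
    rewrite ifF; last by lra.
    by rewrite ifT; [congr extp; lra|lra].
  rewrite min_r; last by lra.
  rewrite /f /g ifF; last by lra.
  by rewrite ifF; [congr extp; lra|lra].
- move=> t; rewrite extp_catp /catp_ext extp_catp /catp_ext.
  case: ifPn => t2.
    rewrite max_l; last by lra.
    by rewrite /f /g ifT; [congr extp; lra|lra].
  rewrite max_r; last by lra.
  case: ifPn => t4; (rewrite /f /g ifF; last by lra).
    by rewrite ifT; [congr extp; lra|lra].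
  by rewrite ifF; [congr extp; lra|lra].
- move=> s; rewrite min_l; last by lra.
  by rewrite max_l; [rewrite f0//; lra|lra].
- move=> s; rewrite min_r; last by lra.
  by rewrite max_r; [rewrite f3//; lra|lra].
Qed.

End Homotopy.

Section FundamentalGroup.
Context (RR : realType) {X : topologicalType} (x : X).
Local Notation loop := {path (unit_interval RR) from x to x}.

Definition loop_eq (p q : loop) : bool := `[< homotopic p q >].

Lemma loop_eq_refl : reflexive loop_eq.
Proof. by move=> p; apply/asboolP; exact: homotopic_refl. Qed.

Lemma loop_eq_sym : symmetric loop_eq.
Proof. by move=> p q; apply/asboolP/asboolP; exact: homotopic_sym. Qed.

Lemma loop_eq_trans : transitive loop_eq.
Proof.
move=> q p r /asboolP pq /asboolP qr; apply/asboolP.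
exact: homotopic_trans pq qr.
Qed.

Canonical loop_equiv :=
  EquivRel loop_eq loop_eq_refl loop_eq_sym loop_eq_trans.

Definition pi1 : Type := {eq_quot loop_equiv}.

HB.instance Definition _ := Choice.on pi1.

Definition loop_class (p : loop) : pi1 := \pi_{eq_quot loop_equiv} p.
Definition loop_repr (g : pi1) : loop := repr (g : {eq_quot loop_equiv}).

Lemma loop_reprK : cancel loop_repr loop_class.
Proof. by move=> g; rewrite /loop_class reprK. Qed.

Lemma loop_classP p q : loop_class p = loop_class q <-> homotopic p q.
Proof. by split=> [/eqmodP/asboolP //|pq]; apply/eqmodP; exact/asboolP. Qed.

Lemma loop_class_repr p : homotopic (loop_repr (loop_class p)) p.
Proof. by apply/loop_classP; rewrite loop_reprK. Qed.

Definition pi1_mul g h := loop_class (catp (loop_repr g) (loop_repr h)).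
Definition pi1_one := loop_class (cstp x).
Definition pi1_inv g := loop_class (revp (loop_repr g)).

Lemma pi1_mulE p q :
  pi1_mul (loop_class p) (loop_class q) = loop_class (catp p q).
Proof.
by apply/loop_classP; apply: homotopic_catp; exact: loop_class_repr.
Qed.

Lemma pi1_mulA : associative pi1_mul.
Proof.
move=> u v w; rewrite -[u]loop_reprK -[v]loop_reprK -[w]loop_reprK !pi1_mulE.
by apply/loop_classP; apply: homotopic_sym; exact: homotopic_catpA.
Qed.

Lemma pi1_mul1 : left_id pi1_one pi1_mul.
Proof.
move=> u; rewrite -[u]loop_reprK pi1_mulE.
by apply/loop_classP; exact: homotopic_cat1p.
Qed.

Lemma pi1_mulr1 : right_id pi1_one pi1_mul.
Proof.
move=> u; rewrite -[u]loop_reprK pi1_mulE.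
by apply/loop_classP; exact: homotopic_catp1.
Qed.

Lemma pi1_mulV : left_inverse pi1_one pi1_inv pi1_mul.
Proof.
move=> u; rewrite -{2}[u]loop_reprK pi1_mulE.
by apply/loop_classP; exact: homotopic_catVp.
Qed.

Lemma pi1_mulrV : right_inverse pi1_one pi1_inv pi1_mul.
Proof.
move=> u; rewrite -{1}[u]loop_reprK pi1_mulE.
by apply/loop_classP; exact: homotopic_catpV.
Qed.

HB.instance Definition _ := isGroup.Build pi1 pi1_mulA pi1_mul1 pi1_mulr1
  pi1_mulV pi1_mulrV.

End FundamentalGroup.

Section InducedMap.
Context {RR : realType} {X Y : topologicalType} (f : continuousType X Y).
Context (x : X) (y : Y) (fxy : f x = y).
Local Notation I := (unit_interval RR).

Section Loop.
Variable p : {path I from x to x}.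

Lemma map_loop_cts : continuous (f \o p).
Proof. exact: cts_fun. Qed.

Lemma map_loop0 : (f \o p) zero = y.
Proof. by rewrite /= path_zero. Qed.

Lemma map_loop1 : (f \o p) one = y.
Proof. by rewrite /= path_one. Qed.

Definition map_loop : {path I from y to y} :=
  mk_path map_loop_cts map_loop0 map_loop1.
End Loop.

Definition pi1_map (g : pi1 RR x) : pi1 RR y :=
  loop_class (map_loop (loop_repr g)).

Lemma homotopic_map_loop (p q : {path I from x to x}) :
  homotopic p q -> homotopic (map_loop p) (map_loop q).
Proof.
move=> [H [cH H0 H1 Hx Hy]]; exists (f \o H).
split=> [z|t|t|s|s]; rewrite /= ?H0 ?H1 ?Hx ?Hy //.
by apply: continuous_comp; [exact: cH|exact: cts_fun].
Qed.

Lemma pi1_map_class (p : {path I from x to x}) :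
  pi1_map (loop_class p) = loop_class (map_loop p).
Proof.
apply/loop_classP; apply: homotopic_map_loop; exact: loop_class_repr.
Qed.

Lemma pi1_map_morphism : monoid.monoid_morphism pi1_map.
Proof.
split=> [|g h].
  rewrite /pi1_map [LHS]pi1_map_class; congr loop_class.
  by apply/path_eqP => t.
rewrite -[g]loop_reprK -[h]loop_reprK.
rewrite [(_ * _)%g in LHS]pi1_mulE !pi1_map_class [RHS]pi1_mulE; congr loop_class.
apply/path_eqP => t /=; rewrite /mk_path /= /mk_path /catp_fun /catp_ext.
by rewrite (fun_if f).
Qed.
End InducedMap.

(* The basis b_1 = 1, ..., b_{n+1} is indexed by 'I_n.+1; fbasisE and fcoordE
   say that it is a Z-basis of R, with coordinate functions fcoord. *)
Record fusion_ring (R : nzRingType) (n : nat) := FusionRing {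
  fbasis : 'I_n.+1 -> R;
  fcoord : 'I_n.+1 -> R -> int;
  fbasisE : forall x : R, x = \sum_i fbasis i *~ fcoord i x;
  fcoordE : forall (c : 'I_n.+1 -> int) j,
    fcoord j (\sum_i fbasis i *~ c i) = c j;
  fbasis0 : fbasis ord0 = 1;
  fmul_neq0 : forall j k, fbasis j * fbasis k != 0;
  fmul_ge0 : forall i j k, 0 <= fcoord i (fbasis j * fbasis k);
  fdual : 'I_n.+1 -> 'I_n.+1;
  fdualK : involutive fdual;
  fstar := fun x : R => \sum_i fbasis (fdual i) *~ fcoord i x;
  fstarM : forall x y : R, fstar (x * y) = fstar y * fstar x;
  fcoord0M : forall j k,
    fcoord ord0 (fbasis j * fbasis k) = if k == fdual j then 1 else 0
}.

Section FusionRing.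
Context {R : nzRingType} {n : nat} (F : fusion_ring R n).
Local Notation b := (fbasis F).

Definition fnonneg (x : R) : Prop := forall i, 0 <= fcoord F i x.

Lemma fcoordD i x y : fcoord F i (x + y) = fcoord F i x + fcoord F i y.
Proof.
rewrite {1}(fbasisE F x) {1}(fbasisE F y) -big_split /=.
under eq_bigr do rewrite -mulrzDr.
by rewrite fcoordE.
Qed.

Lemma fcoord_0 i : fcoord F i 0 = 0.
Proof. by apply: (addrI (fcoord F i 0)); rewrite -fcoordD !addr0. Qed.

Lemma fcoordN i x : fcoord F i (- x) = - fcoord F i x.
Proof. by apply/eqP; rewrite -addr_eq0 -fcoordD addNr fcoord_0. Qed.

Lemma fcoord_sum i (J : Type) (r : seq J) (f : J -> R) :
  fcoord F i (\sum_(j <- r) f j) = \sum_(j <- r) fcoord F i (f j).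
Proof.
elim: r => [|j r IH]; first by rewrite !big_nil fcoord_0.
by rewrite !big_cons fcoordD IH.
Qed.

Lemma fcoordMz i x (m : int) : fcoord F i (x *~ m) = fcoord F i x * m.
Proof.
have natE (k : nat) : fcoord F i (x *+ k) = fcoord F i x * k%:Z.
  elim: k => [|k IH]; first by rewrite mulr0n fcoord_0 mulr0.
  by rewrite mulrS fcoordD IH -addn1 PoszD mulrDr mulr1 addrC.
case: m => k; first exact: natE.
by rewrite NegzE mulrNz fcoordN natE mulrN.
Qed.

Lemma fcoord_basis i j : fcoord F i (b j) = (i == j)%:Z.
Proof.
have -> : b j = \sum_k b k *~ (k == j)%:Z.
  by rewrite (bigD1 j)//= eqxx big1 ?addr0// => k /negbTE->.
by rewrite fcoordE.
Qed.

Lemma fdual0 : fdual F ord0 = ord0.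
Proof.
have := fcoord0M F ord0 ord0; rewrite fbasis0 mul1r -(fbasis0 F) fcoord_basis eqxx.
by case: eqP => // <-.
Qed.

Lemma fcoord_star i x : fcoord F i (fstar F x) = fcoord F (fdual F i) x.
Proof.
rewrite /fstar fcoord_sum (bigD1 (fdual F i))//= fdualK fcoordMz fcoord_basis.
rewrite eqxx mul1r big1 ?addr0// => k ki.
rewrite fcoordMz fcoord_basis; case: eqP => [ik|]; last by rewrite mul0r.
by rewrite ik fdualK eqxx in ki.
Qed.

Lemma fstar_basis i : fstar F (b i) = b (fdual F i).
Proof.
rewrite [RHS](fbasisE F) [LHS](fbasisE F); apply: eq_bigr => j _.
rewrite fcoord_star !fcoord_basis; congr (_ *~ (nat_of_bool _)%:Z).
by rewrite (can2_eq (@fdualK _ _ F) (@fdualK _ _ F)).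
Qed.

Lemma fcoord0_mulE x y :
  fcoord F ord0 (x * y) = \sum_j fcoord F j x * fcoord F (fdual F j) y.
Proof.
rewrite {1}(fbasisE F x) big_distrl /= fcoord_sum; apply: eq_bigr => j _.
rewrite mulrzAl fcoordMz mulrC; congr (_ * _).
rewrite {1}(fbasisE F y) big_distrr /= fcoord_sum (bigD1 (fdual F j))//=.
rewrite mulrzAr fcoordMz fcoord0M eqxx mul1r big1 ?addr0// => k kj.
by rewrite mulrzAr fcoordMz fcoord0M (negbTE kj) mul0r.
Qed.

Lemma fcoord0_mulC x y : fcoord F ord0 (x * y) = fcoord F ord0 (y * x).
Proof.
rewrite !fcoord0_mulE (reindex_inj (can_inj (@fdualK _ _ F))) /=.
by apply: eq_bigr => j _; rewrite fdualK mulrC.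
Qed.

Lemma fcoord_trace i x : fcoord F i x = fcoord F ord0 (b (fdual F i) * x).
Proof.
rewrite fcoord0_mulE (bigD1 (fdual F i))//= fcoord_basis eqxx mul1r fdualK.
by rewrite big1 ?addr0// => k /negbTE ki; rewrite fcoord_basis ki mul0r.
Qed.

Context (RR : realType).

Definition fusion_mx (j : 'I_n.+1) : 'M[RR]_n.+1 :=
  \matrix_(k, l) (fcoord F l (b j * b k))%:~R.

(* The supremum of a finite set, which is non-empty by Perron--Frobenius. *)
Definition FPdim_basis (j : 'I_n.+1) : RR :=
  sup [set a : RR | 0 <= a /\ eigenvalue (fusion_mx j) a].

Definition FPdim (x : R) : RR := \sum_i (fcoord F i x)%:~R * FPdim_basis i.

End FusionRing.

(* The free left R-module R Lambda_S. *)
Notation root_module S R := {ffun S -> R^o}.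

Section RootModule.
Context {S : finType} {R : nzRingType} {n : nat} (F : fusion_ring R n).

Definition simple_root (s : S) : root_module S R := [ffun t => (t == s)%:R].

(* The Z-bilinear form with B(x alpha_s, y alpha_t) = y r_{s,t} x^*. *)
Definition form (r : S -> S -> R) (u v : root_module S R) : R :=
  \sum_s \sum_t v t * r s t * fstar F (u s).

End RootModule.

Arguments simple_root {S} R s.

Record geometric_realisation (RR : realType) (S : finType)
    (M : coxeter_matrix S) (R : nzRingType) (n : nat) (F : fusion_ring R n) :=
  GeometricRealisation {
  gform : S -> S -> R;
  gact : action (coxeter_group M) (root_module S R);
  gact_linear : forall w, linear (gact w);
  gact_gen : forall s v, gact (coxeter_gen M s) v =
    v - form F gform (simple_root R s) v *: simple_root R s;
  gform_diag : forall s, gform s s = 2%:R;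
  gform_nonpos : forall s t, s != t -> fnonneg F (- gform s t);
  gform_star : forall s t, s != t -> gform t s = fstar F (gform s t);
  gform_fin : forall s t m, s != t -> M s t = Some m ->
    FPdim F RR (gform s t) = - 2 * cos (pi / m%:R);
  gform_inf : forall s t, s != t -> M s t = None ->
    FPdim F RR (gform s t) <= - 2
}.

Section Unfolding.
Context {RR : realType} {S : finType} {M : coxeter_matrix S} {R : nzRingType}
  {n : nat} {F : fusion_ring R n} (G : geometric_realisation RR M F).
Local Notation A := ('I_n.+1 * S)%type.
Local Notation b := (fbasis F).
Local Notation V := (root_module S R).
Implicit Types a c d : A.

Definition cform a c : int :=
  if a.2 == c.2 then (if a.1 == c.1 then 2 else 0)
  else fcoord F a.1 (b c.1 * gform G a.2 c.2).

Lemma cform_sym a c : cform a c = cform c a.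
Proof.
rewrite /cform; case: (eqVneq a.2 c.2) => [ac|ac].
  by rewrite [c.1 == _]eq_sym.
rewrite (fcoord_trace F a.1) (fcoord_trace F c.1) -[in LHS](fdual0 F).
rewrite -fcoord_star !fstarM !fstar_basis fdualK (gform_star G ac).
by rewrite [in RHS]mulrA [RHS]fcoord0_mulC mulrA.
Qed.

Lemma cform_diag a : cform a a = 2.
Proof. by rewrite /cform !eqxx. Qed.

Definition unfolded_label a c : option nat :=
  if a == c then Some 1%N
  else if cform a c == 0 then Some 2%N
  else if cform a c == -1 then Some 3%N
  else None.

Lemma unfolded_label_sym a c : unfolded_label a c = unfolded_label c a.
Proof. by rewrite /unfolded_label eq_sym cform_sym. Qed.

Lemma unfolded_label_diag a : unfolded_label a a = Some 1%N.
Proof. by rewrite /unfolded_label eqxx. Qed.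

Lemma unfolded_label_off a c m :
  a != c -> unfolded_label a c = Some m -> (2 <= m)%N.
Proof.
rewrite /unfolded_label => /negbTE->.
by case: eqP => [_ [<-]//|_]; case: eqP => [_ [<-]//|].
Qed.

Definition unfolded_matrix : coxeter_matrix A :=
  CoxeterMatrix unfolded_label_sym unfolded_label_diag unfolded_label_off.

(* The identification of Z Lambda with R Lambda_S. *)
Definition croot a : V := b a.1 *: simple_root R a.2.
Definition ccoord a (v : V) : int := fcoord F a.1 (v a.2).

Definition cbilin (u v : V) : int :=
  \sum_a \sum_c ccoord a u * cform a c * ccoord c v.

Definition crefl a (v : V) : V := v - croot a *~ cbilin (croot a) v.

Lemma ccoord_root a c : ccoord a (croot c) = (a == c)%:Z.
Proof.
rewrite /ccoord /croot ffunE /simple_root ffunE.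
case: a c => [i s] [j t] /=; rewrite xpair_eqE.
case: (eqVneq s t) => [_|st].
  by rewrite andbT [_ *: _]mulr1 fcoord_basis.
by rewrite andbF scaler0 fcoord_0.
Qed.

Lemma ccoordD a u v : ccoord a (u + v) = ccoord a u + ccoord a v.
Proof. by rewrite /ccoord ffunE fcoordD. Qed.

Lemma cbilin_rootl a v : cbilin (croot a) v = \sum_c cform a c * ccoord c v.
Proof.
rewrite /cbilin (bigD1 a)//= [X in _ + X]big1 ?addr0.
  by apply: eq_bigr => c _; rewrite ccoord_root eqxx mul1r.
move=> d /negbTE da; apply: big1 => c _.
by rewrite ccoord_root da !mul0r.
Qed.

Lemma cbilin_root a c : cbilin (croot a) (croot c) = cform a c.
Proof.
rewrite cbilin_rootl (bigD1 c)//= ccoord_root eqxx mulr1 big1 ?addr0//.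
by move=> d /negbTE dc; rewrite ccoord_root dc mulr0.
Qed.

Lemma cbilinDr u v w : cbilin u (v + w) = cbilin u v + cbilin u w.
Proof.
rewrite /cbilin -big_split /=; apply: eq_bigr => a _.
rewrite -big_split /=; apply: eq_bigr => c _.
by rewrite ccoordD mulrDr.
Qed.

Lemma cbilin_nmod u : nmod_morphism (cbilin u).
Proof.
split; last exact: cbilinDr.
by apply: (addrI (cbilin u 0)); rewrite -cbilinDr !addr0.
Qed.

HB.instance Definition _ u :=
  GRing.isNmodMorphism.Build V int (cbilin u) (cbilin_nmod u).

Lemma crefl_comb a c (v : V) (p q : int) :
  crefl a (v + croot a *~ p + croot c *~ q) =
  v + croot a *~ (- cbilin (croot a) v - p - cform a c * q) + croot c *~ q.
Proof.
rewrite /crefl !cbilinDr [cbilin _ (_ *~ p)]raddfMz [cbilin _ (_ *~ q)]raddfMz.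
rewrite /= !cbilin_root cform_diag.
rewrite addrAC; congr (_ + _).
rewrite -addrA; congr (_ + _); rewrite -mulrzBr; congr (_ *~ _).
rewrite !mulrzz; ring.
Qed.

Lemma crefl_rels : coxeter_rels unfolded_matrix crefl.
Proof.
move=> a c m /=; rewrite /unfolded_label => am v.
have reflr (v0 : V) d e (p q : int) : v0 + croot d *~ p + croot e *~ q =
    v0 + croot e *~ q + croot d *~ p by rewrite addrAC.
pose sh (p q : int) : V := v + croot a *~ p + croot c *~ q.
have shE p q p' q' : p = p' -> q = q' -> sh p q = sh p' q' by move=> -> ->.
have sh0 : sh 0 0 = v by rewrite /sh !mulr0z !addr0.
pose x := cbilin (croot a) v; pose y := cbilin (croot c) v.
have ca p q : crefl a (sh p q) = sh (- x - p - cform a c * q) q.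
  exact: crefl_comb.
have cc p q : crefl c (sh p q) = sh p (- y - q - cform a c * p).
  by rewrite /sh reflr crefl_comb -cform_sym reflr.
move: am; case: eqP => [ac [<-]|_].
  rewrite /= -ac -{1}sh0 !ca -[RHS]sh0; apply: shE => //; ring.
case: eqP => [c0 [<-]|_].
  rewrite /= -{1}sh0 !(cc, ca) c0 -[RHS]sh0; apply: shE; ring.
case: eqP => [c1 [<-]|//].
rewrite /= -{1}sh0 !(cc, ca) c1 -[RHS]sh0; apply: shE; ring.
Qed.

Definition unfolded_action : action (coxeter_group unfolded_matrix) V :=
  coxeter_action crefl_rels.

(* The order of the factors is immaterial, as they commute. *)
Definition unfolding : coxeter_group M -> coxeter_group unfolded_matrix :=
  coxeter_lift
    (fun s => \prod_(i < n.+1) coxeter_gen unfolded_matrix (i, s))%g.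

End Unfolding.

(* W acts on V, and Theta is a space of functions V -> RR with the topology of
   pointwise convergence.  If V is a finitely generated abelian group and Theta
   a real vector space of additive maps, then this is the usual topology of the
   finite-dimensional space Theta. *)
Section TitsCone.
Context {RR : realType} {S : finType} {M : coxeter_matrix S} {V : Type}.
Context (act : action (coxeter_group M) V) (alpha : S -> V).
Context (Theta : set {ptws V -> RR}).
Local Notation W := (coxeter_group M).
Local Notation D := {ptws V -> RR}.

Definition dual_act (w : W) (Z : D) : D := fun v => Z (act w^-1%g v).

(* Interior relative to the subspace Theta; used for E included in Theta. *)
Definition dual_interior (E : set D) : set D :=
  Theta `&` [set Z | within Theta (nbhs Z) E].

Definition chamber : set D := Theta `&` [set Z | forall s, 0 <= Z (alpha s)].

Definition open_chamber : set D := dual_interior chamber.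

Definition tits_cone : set D :=
  dual_interior (\bigcup_(w in [set: W]) dual_act w @` chamber).

Definition mirrors : set (set D) :=
  [set H | exists w s, H = Theta `&`
    [set Z | dual_act (w * coxeter_gen M s * w^-1)%g Z = Z]].

Definition regular : set (D * D) :=
  (tits_cone `*` tits_cone) `\` \bigcup_(H in mirrors) (H `*` H).

Definition diag_act (w : W) (z : D * D) : D * D :=
  (dual_act w z.1, dual_act w z.2).

Lemma diag_act1 z : diag_act 1%g z = z.
Proof.
by case: z => Z1 Z2; congr (_, _); apply/funext => v;
  rewrite /dual_act invg1 act1.
Qed.

Lemma diag_actM w w' z : diag_act (w * w')%g z = diag_act w (diag_act w' z).
Proof.
by congr (_, _); apply/funext => v; rewrite /dual_act invgM actM.
Qed.

Definition same_orbit (x y : regular) : bool :=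
  `[< exists w, val y = diag_act w (val x) >].

Lemma same_orbit_refl : reflexive same_orbit.
Proof. by move=> x; apply/asboolP; exists 1%g; rewrite diag_act1. Qed.

Lemma same_orbit_sym : symmetric same_orbit.
Proof.
have H x y : same_orbit x y -> same_orbit y x.
  move=> /asboolP[w xy]; apply/asboolP; exists w^-1%g.
  by rewrite xy -diag_actM mulVg diag_act1.
by move=> x y; apply/idP/idP; exact: H.
Qed.

Lemma same_orbit_trans : transitive same_orbit.
Proof.
move=> y x z /asboolP[w xy] /asboolP[w' yz]; apply/asboolP; exists (w' * w)%g.
by rewrite diag_actM -xy.
Qed.

Canonical same_orbit_equiv :=
  EquivRel same_orbit same_orbit_refl same_orbit_sym same_orbit_trans.

Definition orbit_space : Type := quotient_topology {eq_quot same_orbit_equiv}.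

HB.instance Definition _ := Topological.on orbit_space.

Definition orbit_of (x : regular) : orbit_space :=
  \pi_(quotient_topology {eq_quot same_orbit_equiv}) x.

(* The surjection pi_1(regular / W) -> W: the element w such that the
   lift starting at x of some (equivalently, every) loop in the class ends at
   w x.  It exists and is unique as W acts freely and properly
   discontinuously; the value 1 is a mere default. *)
Definition monodromy (x : regular) (g : pi1 RR (orbit_of x)) : W :=
  xget 1%g [set w : W |
    exists (p : {path (unit_interval RR) from orbit_of x to orbit_of x})
           (y : regular) (q : {path (unit_interval RR) from x to y}),
      [/\ loop_class p = g, forall t, orbit_of (q t) = p t &
          val y = diag_act w (val x)]].

End TitsCone.

Arguments orbit_of {RR S M V act alpha Theta} x.
Arguments monodromy {RR S M V act alpha Theta} x g.

Section Complements.
Context {RR : realType} {S : finType} {M : coxeter_matrix S} {R : nzRingType}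
  {n : nat} {F : fusion_ring R n} (G : geometric_realisation RR M F).
Local Notation V := (root_module S R).

(* Hom_Z(R Lambda_S, RR) and Hom_R(R Lambda_S, RR). *)
Definition cTheta : set {ptws V -> RR} :=
  [set Z | forall u v : V, Z (u + v) = Z u + Z v].

Definition Theta : set {ptws V -> RR} :=
  cTheta `&` [set Z | forall (r : R) (v : V), Z (r *: v) = FPdim F RR r * Z v].

Definition Omega_reg := regular (gact G) (simple_root R) Theta.

Definition cOmega_reg := regular (unfolded_action G) (@croot S R n F) cTheta.

End Complements.

Arguments Theta {RR S R n} F.

Definition point_in (T : Type) (A : set T) (x : T) (Ax : A x) : A :=
  exist _ x (mem_set Ax).

Definition inclusion (T : Type) (A B : set T) (AB : A `<=` B) (x : A) : B :=
  point_in (AB _ (set_valP x)).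

(* Main.v *)
(* A root of the unfolded group is a non-negative or a non-positive combination
   of the simple roots.  Hence its action on R Lambda_S is faithful, and as
   phi(s) acts on R Lambda_S as s does, phi is a homomorphism.

   By Perron--Frobenius FPdim is a character of R, positive on the basis, so
   that Theta contains points that are positive on all simple roots.  A
   functional belongs to the orbit of the closed unfolded chamber iff it is
   negative on finitely many positive roots only, and it belongs to the
   interior of this orbit iff the same holds after subtracting a small multiple
   of a point of the open chamber; therefore the Tits cone of W is contained in
   that of the unfolded group.  If Z1, Z2 in Theta vanish on a common root, move
   Z1 into the chamber and then make Z2 dominant on the simple roots killed by
   Z1, using elements of W only: now Z1 and Z2 vanish on a common simple root of
   W.  This gives the inclusion of the complements of the mirrors.  The same
   argument inside the unfolded group shows that it acts freely on its
   complement, and a bound on the number of inversions that it acts properly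
   discontinuously.

   Finally the lift of a loop of Omega_reg / W, seen in the unfolded complement,
   lifts the image loop and ends at phi(w) x, and homotopic loops have lifts
   with the same end point. *)

Require Import Defs.
From HB Require Import structures.
From mathcomp Require Import all_boot all_order all_algebra.
From mathcomp Require Import all_classical all_reals all_analysis.
From mathcomp Require Import homotopy ring lra zify.

Set Implicit Arguments.
Unset Strict Implicit.
Unset Printing Implicit Defensive.

Import Order.TTheory GRing.Theory Num.Theory.
Import numFieldNormedType.Exports.

Local Open Scope classical_set_scope.
Local Open Scope ring_scope.

#[local] Arguments act : simpl never.

(** * Lifting of paths along orbit maps *)

(** The real line is connected, and both [A] and its negation are open. The lifting arguments below
    use this in place of subdividing a compact interval. *)
Lemma locally_constant_constant (RR : realType) (A : RR -> Prop) :
  (forall t, \forall u \near t, A t <-> A u) -> forall a b, A a -> A b.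
Proof.
move=> lA a b Aa.
have oA : open [set t | A t].
  rewrite openE => t /= At; rewrite /interior /=.
  by apply: filterS (lA t) => u [+ _]; apply.
have oNA : open [set t | ~ A t].
  rewrite openE => t /= At; rewrite /interior /=.
  by apply: filterS (lA t) => u [_ +] => /contra_not; apply.
have cA : closed [set t | A t].
  rewrite -openC; apply: (eq_rect _ open oNA).
  by apply/seteqP; split.
suff AT : [set t | A t] = [set: RR] by have : [set: RR] b by []; rewrite -AT.
have /connected_intervalP : is_interval [set: RR] by [].
by apply; [exists a|exists [set t | A t]; rewrite ?setTI..].
Qed.

Section Covering.
Context {RR : realType} {G : groupType} {E Q : topologicalType}.
Variables (act : action G E) (proj : E -> Q).
Hypothesis act_cts : forall g, continuous (act g).
Hypothesis projP : forall x y, proj x = proj y <-> exists g, y = act g x.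
Hypothesis proj_surj : forall y, exists x, proj x = y.
Hypothesis proj_open : forall U : set E, open U -> open (proj @` U).

(* Translates of [U] are only required to coincide when they meet, so that the
   covering theory of [W] does not depend on the injectivity of phi. *)
Definition wandering (U : set E) :=
  forall g z, U z -> U (act g z) -> forall e, act g e = e.

Hypothesis wander : forall x, exists2 U : set E, open_nbhs x U & wandering U.

Lemma actK g : cancel (act g) (act g^-1%g).
Proof. by move=> x; rewrite -actM mulVg act1. Qed.

Lemma actVK g : cancel (act g^-1%g) (act g).
Proof. by move=> x; rewrite -actM mulgV act1. Qed.

Lemma act_proj g x : proj (act g x) = proj x.
Proof. by apply/esym/projP; exists g. Qed.

Section Sheet.
Variables (U : set E) (x : E).
Hypotheses (oU : open U) (wU : wandering U).

(** The local section of [proj] over the image of [U]; [x] is a default off that image. *)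
Definition sheet (y : Q) : E := xget x [set z | U z /\ proj z = y].

Lemma sheetP y : (proj @` U) y -> U (sheet y) /\ proj (sheet y) = y.
Proof.
case=> z Uz zy; apply: (@xgetPex _ x [set z | U z /\ proj z = y]).
by exists z.
Qed.

Lemma wandering_inj z z' : U z -> U z' -> proj z = proj z' -> z = z'.
Proof. by move=> Uz + /projP[g zz']; rewrite zz' => Uz'; rewrite (wU Uz Uz'). Qed.

Lemma sheet_proj z : U z -> sheet (proj z) = z.
Proof.
move=> Uz; have [Us ps] := sheetP (ex_intro2 _ _ z Uz erefl).
exact: wandering_inj.
Qed.

(** The map [proj] is open, and [sheet] sends the image of the intersection of [B1] and [U] back
    into [B1]. *)
Lemma sheet_continuous y : (proj @` U) y -> {for y, continuous sheet}.
Proof.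
move=> yU; have [Us ps] := sheetP yU; move=> B; rewrite /= nbhsE => -[B1 [oB1 B1y] B1B].
have : open_nbhs y (proj @` (B1 `&` U)).
  by split; [exact/proj_open/openI|exists (sheet y)].
move=> /open_nbhs_nbhs; apply: filterS => _ [z [B1z Uz] <-].
by rewrite /= sheet_proj//; exact: B1B.
Qed.

Lemma near_sheet (P : RR -> Q) (t0 : RR) : continuous P -> (proj @` U) (P t0) ->
  \forall t \near t0, (proj @` U) (P t).
Proof.
move=> cP Pt; apply: (cP t0); apply: open_nbhs_nbhs; split => //.
exact: proj_open.
Qed.

Lemma lift_sheet (P : RR -> Q) t1 t2 e : continuous P -> t1 <= t2 ->
  (forall t, t1 <= t <= t2 -> (proj @` U) (P t)) -> proj e = P t1 ->
  exists2 q : RR -> E, continuous q & (forall t, t <= t1 -> q t = e) /\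
    (forall t, t1 <= t <= t2 -> proj (q t) = P t).
Proof.
move=> cP t12 PU pe.
have [Us ps] : U (sheet (P t1)) /\ proj (sheet (P t1)) = P t1.
  by apply/sheetP/PU; rewrite lexx.
have [g ge] : exists g, e = act g (sheet (P t1)) by apply/projP; rewrite ps.
(* Time is clamped to the interval, so that a translate of the sheet gives a path on the whole line,
   constant before [t1] and therefore ready for pasting. *)
pose c t := Num.max t1 (Num.min t t2).
have cc : continuous c.
  apply: max_cts; first exact: cst_continuous.
  by apply: min_cts; [move=> t; exact: cvg_id|exact: cst_continuous].
have cE t : t1 <= c t <= t2 by rewrite /c le_max lexx ge_max t12 ge_min lexx orbT.
exists (fun t => act g (sheet (P (c t)))).
  move=> t; apply: (@continuous_comp _ _ _ (fun t => sheet (P (c t)))).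
    apply: (@continuous_comp _ _ _ (fun t => P (c t))); first exact: (comp_cts cc cP).
    exact/sheet_continuous/PU/cE.
  exact: act_cts.
split=> t; first by move=> tt1; rewrite /c min_l ?(le_trans tt1)// max_l// -ge.
move=> /andP[tt1 tt2]; rewrite act_proj /c min_l// max_r//.
by have [] := sheetP (PU t _); rewrite ?tt1.
Qed.

(** The preimage of the image of [U] is the union of the open translates of [U], and translates that
    meet coincide; a path cannot leave one of them. *)
Lemma stay_sheet (q : RR -> E) t1 t2 : continuous q ->
  (forall t, (proj @` U) (proj (q t))) -> U (q t1) -> U (q t2).
Proof.
move=> cq qU; move: t1 t2; apply: (@locally_constant_constant _ (U \o q)) => t /=.
have [z Uz /projP[g qz]] := qU t.
have : \forall u \near t, U (act g^-1%g (q u)).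
  have C := @comp_cts _ _ _ _ _ cq (@act_cts g^-1%g); apply: (C t).
  by apply: open_nbhs_nbhs; split; rewrite // qz actK.
apply: filterS => u Uu; split => Uq.
  have ge e : act g e = e by apply: (wU Uz); rewrite -qz.
  by rewrite -[q u](actVK g) ge.
have Vge e : act g^-1%g e = e by exact: (wU Uq).
by rewrite qz -[z]Vge actVK.
Qed.

End Sheet.

(** Near any time the two lifts differ by one fixed [g], so they agree at a nearby time exactly when
    [g] acts trivially. *)
Lemma lift_unique (q q' : RR -> E) : continuous q -> continuous q' ->
  (forall t, proj (q t) = proj (q' t)) -> forall a b, q a = q' a -> q b = q' b.
Proof.
move=> cq cq' qq'; apply: locally_constant_constant => t.
have [U [oU Ut] wU] := wander (q t).
have [g qg] := (projP (q t) (q' t)).1 (qq' t).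
have near1 : \forall u \near t, U (q u) by apply: (cq t); exact: open_nbhs_nbhs.
have : \forall u \near t, U (act g^-1%g (q' u)).
  have C := @comp_cts _ _ _ _ _ cq' (@act_cts g^-1%g); apply: (C t).
  by apply: open_nbhs_nbhs; split; rewrite // qg actK.
move: near1; apply: filterS2 => u Uu Uu'.
have q'u : q' u = act g (q u).
  have [h qh] := (projP (q u) (q' u)).1 (qq' u).
  have Vh : act (g^-1 * h)%g (q u) = q u by apply: (wU _ _ Uu); rewrite actM -qh.
  by rewrite -[in RHS]Vh actM -qh actVK.
rewrite qg q'u; split => eg; apply/esym.
  by apply: (wU g _ Ut); rewrite -eg.
by apply: (wU g _ Uu); rewrite -eg.
Qed.

Lemma path_lifting (P : RR -> Q) e : continuous P -> proj e = P 0 ->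
  exists2 q : RR -> E, continuous q &
    q 0 = e /\ forall t, 0 <= t <= 1 -> proj (q t) = P t.
Proof.
move=> cP Pe.
(* Having a lift up to time [c] is a locally constant condition on [c]: it holds for [c <= 0], and a
   lift extends over any interval that [P] maps into the image of one wandering set. *)
pose A c := exists2 q : RR -> E, continuous q &
  q 0 = e /\ forall t, 0 <= t <= c -> proj (q t) = P t.
have A0 : A 0.
  exists (fun=> e); first exact: cst_continuous.
  by split=> // t /andP[t0 t0']; rewrite (_ : t = 0)//; apply/eqP; rewrite eq_le t0 t0'.
have mono c c' : c' <= c -> A c -> A c'.
  move=> cc [q cq [q0 qP]]; exists q => //; split=> // t /andP[t0 tc].
  by apply: qP; rewrite t0 (le_trans tc).
have Aneg c : c <= 0 -> A c by move=> c0; exact: mono A0.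
have ext (U : set E) t1 t2 : open U -> wandering U -> t1 <= t2 ->
    (forall t, t1 <= t <= t2 -> (proj @` U) (P t)) -> A t1 -> A t2.
  move=> oU wU t12 PU At1; case: (leP t2 0) => [/Aneg//|t2_gt0].
  wlog t10 : t1 t12 PU At1 / 0 <= t1.
    move=> H; case: (leP 0 t1) => [|/ltW t10]; first exact: H At1.
    apply: (H 0 _ _ A0) => //; first exact: ltW.
    by move=> t /andP[t0 tt2]; apply: PU; rewrite tt2 (le_trans t10).
  have [q cq [q0 qP]] := At1.
  have [|r cr [rl rP]] := lift_sheet (e := q t1) e oU wU cP t12 PU.
    by rewrite qP// t10 lexx.
  exists (fun t => if t <= t1 then q t else r t).
    by apply: (@continuous_pasting RR E RR q r id t1) => // [t|t ->] //; rewrite rl.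
  split=> [|t /andP[t0 tt2]]; first by rewrite t10.
  by case: leP => tt1; [apply: qP; rewrite t0|apply: rP; rewrite ltW].
move: A0; apply: locally_constant_constant => t.
have [x px] := proj_surj (P t).
have [U [oU Ux] wU] := wander x.
have [d /= d0 dU] : \forall u \near t, (proj @` U) (P u).
  by apply: near_sheet => //; exists x.
exists d => //= u /= ut; rewrite /ball_/= in ut.
have PU v : `|t - v| <= `|t - u| -> (proj @` U) (P v).
  by move=> tv; exact/dU/(le_lt_trans tv).
case: (leP t u) => tu; split => Au.
- apply: (ext U t u oU wU tu _ Au) => v /andP[tv vu]; apply: PU.
  by rewrite !ler0_norm ?subr_le0// !opprB lerD2r.
- exact: mono Au.
- exact: mono (ltW tu) Au.
- apply: (ext U u t oU wU (ltW tu) _ Au) => v /andP[uv vt]; apply: PU.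
  by rewrite !ger0_norm ?subr_ge0// ?(ltW tu)// lerD2l lerN2.
Qed.

(* Continuity of [L ^~ t] at a given point is a locally constant condition on
   [t], which holds at [t = 0]. *)
Lemma homotopy_lift_end (K : RR * RR -> Q) (L : RR -> RR -> E) :
  continuous K -> (forall s, continuous (L s)) ->
  (forall s t, proj (L s t) = K (s, t)) ->
  (forall s s', L s 0 = L s' 0) -> (forall s s', K (s, 1) = K (s', 1)) ->
  forall s s', L s 1 = L s' 1.
Proof.
move=> cK cL LK L0 K1.
have cLt (s0 t : RR) : {for s0, continuous (L ^~ t)}.
  have : {for s0, continuous (L ^~ 0)}.
    rewrite (_ : L ^~ 0 = cst (L s0 0)); first exact: cst_continuous.
    by apply/funext => s; exact: L0.
  apply: (@locally_constant_constant _ (fun t => {for s0, continuous (L ^~ t)})) => {}t.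
  have [U [oU Ut] wU] := wander (L s0 t).
  have : \forall z \near (s0, t), (proj @` U) (K z).
    apply: (cK (s0, t)); apply: open_nbhs_nbhs; split; first exact: proj_open.
    by exists (L s0 t) => //.
  case=> -[N1 N2] /= [[d1 /= d10 dN1] [d2 /= d20 dN2]] NU.
  have KU s u : `|s0 - s| < d1 -> `|t - u| < d2 -> (proj @` U) (K (s, u)).
    by move=> ss tu; apply: NU; split => /=; [exact: dN1|exact: dN2].
  (* [c u] clamps to the interval of radius [u] around [t]. With the larger of the two distances as
     radius, the clamped path stays where [K] takes values in the image of [U], so that [stay_sheet]
     applies. *)
  pose c u v := Num.max (t - u) (Num.min (t + u) v).
  have stay s u v : `|s0 - s| < d1 -> `|t - u| < d2 -> `|t - v| < d2 ->
      U (L s u) -> U (L s v).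
    move=> ss tu tv.
    pose r := Num.max `|t - u| `|t - v|.
    have rd : r < d2 by rewrite /r gt_max tu.
    have r0 : 0 <= r by rewrite le_max normr_ge0.
    have cr x : `|t - c r x| <= r.
      rewrite ler_norml /c; have [h|h] := leP (t + r) x.
        by rewrite max_r; lra.
      by case: (leP (t - r) x) => h'; lra.
    have cid x : `|t - x| <= r -> c r x = x.
      by rewrite ler_norml => /andP[h1 h2]; rewrite /c min_r ?max_r; lra.
    have := @stay_sheet U oU wU (fun x => L s (c r x)) u v.
    rewrite !cid ?le_max ?lexx ?orbT//; apply.
      apply: comp_cts (cL s); apply: max_cts; first exact: cst_continuous.
      by apply: min_cts; [exact: cst_continuous|move=> x; exact: cvg_id].
    by move=> x; rewrite LK; apply: KU => //; exact: le_lt_trans (cr x) rd.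
  have nears : \forall s \near s0, `|s0 - s| < d1 by exists d1.
  have step u v : `|t - u| < d2 -> `|t - v| < d2 -> {for s0, continuous (L ^~ u)} ->
      {for s0, continuous (L ^~ v)}.
    move=> tu tv cu B; rewrite /= nbhsE; case=> B1 [oB1 B1v] B1B.
    have U0 w : `|t - w| < d2 -> U (L s0 w).
      by move=> tw; apply: (stay s0 t w) => //; rewrite subrr normr0.
    have n1 : \forall s \near s0, U (L s u).
      by apply: cu; apply: open_nbhs_nbhs; split => //; exact: U0.
    have n2 : \forall s \near s0, (proj @` (B1 `&` U)) (K (s, v)).
      have : \forall z \near (s0, v), (proj @` (B1 `&` U)) (K z).
        apply: (cK (s0, v)); apply: open_nbhs_nbhs; split; first exact/proj_open/openI.
        by exists (L s0 v) => //; split => //; exact: U0.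
      case=> -[M1 M2] /= [M1s M2v] MO; apply: filterS M1s => s M1s.
      by apply: MO; split => //=; exact: nbhs_singleton.
    suff : \forall s \near s0, B (L s v) by [].
    near=> s; apply: B1B.
    have [z [B1z Uz] zK] : (proj @` (B1 `&` U)) (K (s, v)) by near: s.
    suff -> : L s v = z by [].
    apply: (wandering_inj wU) => //; last by rewrite LK.
    by apply: (stay s u v) => //; near: s.
  exists d2 => //= u tu; split; apply: step => //; by rewrite subrr normr0.
(* All ends [L s 1] lie over one point, and by continuity nearby ones lie in one sheet. *)
move=> s s'; move: (erefl (L s 1)).
apply: (@locally_constant_constant _ (fun s' => L s 1 = L s' 1)) => u.
have [U [oU Uu] wU] := wander (L u 1).
have : \forall v \near u, U (L v 1) by apply: cLt; exact: open_nbhs_nbhs.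
apply: filterS => v Uv; rewrite (_ : L v 1 = L u 1)//.
by apply: (wandering_inj wU) => //; rewrite !LK.
Unshelve. all: by end_near.
Qed.
End Covering.

(** * The Frobenius--Perron dimension *)

Lemma cvg_sumr (RR : realType) (T : Type) (H : set_system T) (I : finType)
    (f : I -> T -> RR) (a : I -> RR) : Filter H ->
  (forall i, f i x @[x --> H] --> a i) ->
  \sum_i f i x @[x --> H] --> \sum_i a i.
Proof. by move=> FF fa; apply: cvg_big => //; exact: add_continuous. Qed.

(** * Perron eigenvectors of positive matrices *)

Section PerronFrobenius.
Context {RR : realType} {n : nat}.
Local Notation I := 'I_n.+1.
Variable A : I -> I -> RR.
Hypothesis A_gt0 : forall i j, 0 < A i j.

Let mulA (x : I -> RR) i := \sum_j A i j * x j.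

Lemma exists_small (a c : I -> RR) : (forall i, 0 < a i) -> (forall i, 0 < c i) ->
  exists2 e : RR, 0 < e & forall i, e * c i <= a i.
Proof.
move=> a0 c0; have s0 : 0 < 1 + \sum_i c i / a i.
  by rewrite ltr_wpDr// sumr_ge0// => i _; rewrite divr_ge0// ltW.
exists (1 + \sum_i c i / a i)^-1; first by rewrite invr_gt0.
move=> i; rewrite mulrC ler_pdivrMr// -ler_pdivrMl// mulrC.
rewrite (bigD1 i)//= addrCA lerDl addr_ge0// sumr_ge0// => j _.
by rewrite divr_ge0// ltW.
Qed.

Lemma mulA_gt0 (x : I -> RR) : (forall i, 0 <= x i) -> (exists i, x i != 0) ->
  forall i, 0 < mulA x i.
Proof.
move=> x0 [k xk] i; rewrite /mulA (bigD1 k)//= ltr_pwDl//.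
  by rewrite mulr_gt0// lt_neqAle eq_sym xk x0.
by rewrite sumr_ge0// => j _; rewrite mulr_ge0// ltW.
Qed.

(** Subtract from [e] the largest multiple of [d] that leaves it non-negative. The difference
    vanishes at [k]; were it non-zero, its image under the positive matrix would be positive at [k],
    yet this image is [lam] times the difference. *)
Lemma Perron_simple (lam : RR) (d e : I -> RR) : (forall i, 0 < d i) ->
  (forall i, mulA d i = lam * d i) -> (forall i, mulA e i = lam * e i) ->
  exists t, forall i, e i = t * d i.
Proof.
move=> d0 Ad Ae.
case: (@arg_minP _ _ _ (ord0 : I) predT (fun i => e i / d i) isT) => k _ kmin.
pose t := e k / d k; exists t => i; apply/eqP; rewrite -subr_eq0; apply/eqP.
have y0 j : 0 <= e j - t * d j by rewrite subr_ge0 -ler_pdivlMr// kmin.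
apply/eqP/negP => /negP yi.
have := mulA_gt0 y0 (ex_intro _ i yi) k.
rewrite (_ : mulA _ k = lam * (e k - t * d k)).
  by rewrite /t divfK ?gt_eqF// subrr mulr0 ltxx.
rewrite /mulA; under eq_bigr do rewrite mulrBr mulrCA.
by rewrite sumrB -mulr_sumr -/(mulA d k) -/(mulA e k) Ad Ae mulrBr mulrCA.
Qed.

(* Collatz--Wielandt: the largest rho such that A x >= rho x for some x in the
   standard simplex is an eigenvalue. *)
Lemma Perron_exists : exists (lam : RR) (d : I -> RR),
  (forall i, 0 < d i) /\ forall i, mulA d i = lam * d i.
Proof.
pose M := \sum_i \sum_j A i j.
pose v (z : RR * 'rV[RR]_n.+1) i := z.2 ord0 i.
have cv i : continuous (v ^~ i).
  by move=> z; apply: (@continuous_comp _ _ _ snd (fun u : 'rV_n.+1 => u ord0 i));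
    [exact: cvg_snd|exact: coord_continuous].
pose C := [set z : RR * 'rV[RR]_n.+1 | \sum_i v z i = 1] `&`
  \bigcap_(i in [set: I]) [set z | 0 <= mulA (v z) i - z.1 * v z i].
have cC : closed C.
  apply: closedI.
    apply: (@closed_comp _ _ (fun z => \sum_i v z i) [set 1]); last exact: closed_eq.
    by move=> z _; apply: cvg_sumr => i; exact: cv.
  apply: closed_bigI => i _.
  apply: (@closed_comp _ _ (fun z => mulA (v z) i - z.1 * v z i)
    [set x | 0 <= x]); last exact: closed_ge.
  move=> z _; apply: cvgB.
    by apply: cvg_sumr => j; apply: cvgM; [exact: cvg_cst|exact: cv].
  by apply: cvgM; [exact: cvg_fst|exact: cv].
(* The pairs [(rho, x)] with [x] in the simplex and [A x >= rho x] satisfy [rho <= M], the sum of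
   all entries; imposing this bound makes the set compact. *)
pose K := (`[0, M]%classic `*` [set u : 'rV[RR]_n.+1 |
  forall i, (`[0, 1]%classic : set RR) (u ord0 i)]) `&` C.
have cK : compact K.
  apply: compact_closedI => //; apply: compact_setX; first exact: segment_compact.
  by apply: (@rV_compact RR _ (fun=> `[0, 1]%classic)) => i; exact: segment_compact.
pose x1 : 'rV[RR]_n.+1 := \row_j (j == ord0)%:R.
have M0 : 0 <= M by apply: sumr_ge0 => i _; apply: sumr_ge0 => j _; exact: ltW.
have K1 : K (0, x1).
  split; last split => [|i _] /=.
  - split=> [|i] /=; rewrite in_itv /= ?lexx ?M0// mxE.
    by case: eqP; rewrite lexx ler01.
  - rewrite (bigD1 ord0)//= /v /= mxE eqxx big1 ?addr0// => i i0.
    by rewrite mxE (negbTE i0).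
  - rewrite mul0r subr0; apply: sumr_ge0 => j _.
    by apply: mulr_ge0; [exact: ltW|rewrite /v mxE; case: eqP].
have [|c cK' cmax] := @compact_EVT_max _ _ (fst : RR * 'rV[RR]_n.+1 -> RR) _
  (ex_intro _ _ K1) cK.
  by apply: continuous_subspaceT => z; exact: cvg_fst.
move: cK'; rewrite inE => -[[c1 c2] [vc Ac]].
have v0 i : 0 <= v c i by have := c2 i; rewrite /= in_itv /= => /andP[].
have vn0 : exists i, v c i != 0.
  apply: contrapT => h; have : \sum_i v c i == 0.
    by rewrite big1// => i _; apply/eqP/negP => /negP vi; apply: h; exists i.
  by rewrite vc oner_eq0.
have z0 := mulA_gt0 v0 vn0.
have Ey : forall i, mulA (v c) i = c.1 * v c i.
  (* If [y = A x - rho x] is non-zero, then [A y] is positive everywhere, so [A x], rescaled to the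
     simplex, admits some [rho + e] with [e > 0], against maximality. *)
  apply: contrapT => /existsNP[k /eqP]; rewrite -subr_eq0 => yk.
  pose y i := mulA (v c) i - c.1 * v c i.
  have yA i : mulA y i = mulA (mulA (v c)) i - c.1 * mulA (v c) i.
    rewrite /y {1}/mulA; under eq_bigr do rewrite mulrBr mulrCA.
    by rewrite sumrB -mulr_sumr.
  have y0 i : 0 <= y i by exact: Ac.
  have [e e0 ez] := exists_small (mulA_gt0 y0 (ex_intro _ k yk)) z0.
  pose s := \sum_i mulA (v c) i.
  have s0 : 0 < s.
    by rewrite /s (bigD1 ord0)//= ltr_pwDl// sumr_ge0// => i _; exact: ltW.
  pose x' : 'rV[RR]_n.+1 := \row_j (mulA (v c) j / s).
  have x'E i : v (c.1 + e, x') i = mulA (v c) i / s by rewrite /v mxE.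
  have sumx' : \sum_i v (c.1 + e, x') i = 1.
    by under eq_bigr do rewrite x'E; rewrite -mulr_suml divff// gt_eqF.
  have Ax' i : 0 <= mulA (v (c.1 + e, x')) i - (c.1 + e) * v (c.1 + e, x') i.
    rewrite x'E (_ : mulA _ i = mulA (mulA (v c)) i / s).
      rewrite mulrA -mulrBl divr_ge0 ?(ltW s0)// mulrDl opprD addrA -yA subr_ge0.
      exact: ez.
    by rewrite /mulA mulr_suml; apply: eq_bigr => j _; rewrite x'E mulrA.
  have x'1 i : 0 <= v (c.1 + e, x') i <= 1.
    rewrite x'E divr_ge0 ?(ltW (z0 _)) ?(ltW s0)//= ler_pdivrMr// mul1r.
    by rewrite /s (bigD1 i)//= lerDl sumr_ge0// => j _; exact: ltW.
  have : K (c.1 + e, x').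
    split; last by split=> // i _; exact: Ax'.
    split=> [|i]; rewrite /= in_itv /=; last exact: x'1.
    move: c1; rewrite /= in_itv /= => /andP[c10 _]; rewrite addr_ge0 ?(ltW e0)//=.
    rewrite -[leLHS]mulr1 -sumx' mulr_sumr; apply: ler_sum => i _.
    apply: (@le_trans _ _ (mulA (v (c.1 + e, x')) i)); first by rewrite -subr_ge0.
    by apply: ler_sum => j _; rewrite ler_piMr ?(ltW (A_gt0 _ _))//; case/andP: (x'1 j).
  by move/mem_set/cmax; rewrite /= gerDl leNgt e0.
exists c.1, (v c); split => // i; rewrite lt_neqAle v0 andbT eq_sym.
by apply/eqP => vi; have := z0 i; rewrite Ey vi mulr0 ltxx.
Qed.
End PerronFrobenius.

(** * The Frobenius--Perron dimension as a character of the fusion ring *)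

Section FPdimMorphism.
Context {RR : realType} {R : nzRingType} {n : nat} (F : fusion_ring R n).
Local Notation b := (fbasis F).
Local Notation I := 'I_n.+1.

(** [FPdim] is the case where [c] is [FPdim_basis]; eigenvectors and candidate characters are
    extended in the same way. *)
Definition basis_ext (c : I -> RR) (x : R) : RR := \sum_i (fcoord F i x)%:~R * c i.

Lemma basis_extD c x y : basis_ext c (x + y) = basis_ext c x + basis_ext c y.
Proof.
rewrite -big_split /=; apply: eq_bigr => i _.
by rewrite fcoordD intrD mulrDl.
Qed.

Lemma basis_ext_nmod c : nmod_morphism (basis_ext c).
Proof.
split; last exact: basis_extD.
by apply: (addrI (basis_ext c 0)); rewrite -basis_extD !addr0.
Qed.

HB.instance Definition _ c :=
  GRing.isNmodMorphism.Build R RR (basis_ext c) (basis_ext_nmod c).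

Lemma basis_ext_basis c j : basis_ext c (b j) = c j.
Proof.
rewrite /basis_ext (bigD1 j)//= fcoord_basis eqxx mul1r big1 ?addr0// => i ij.
by rewrite fcoord_basis (negbTE ij) mul0r.
Qed.

Lemma morph_basis_ext (f : R -> RR) x : {morph f : x y / x + y} ->
  f x = basis_ext (f \o b) x.
Proof.
move=> fD.
have f0 : f 0 = 0 by apply: (addrI (f 0)); rewrite -fD !addr0.
pose g : {additive R -> RR} :=
  HB.pack f (GRing.isNmodMorphism.Build R RR f (conj f0 fD)).
rewrite -[f]/(g : R -> RR) [in LHS](fbasisE F x) raddf_sum /basis_ext.
by apply: eq_bigr => i _; rewrite raddfMz mulrC mulrzr.
Qed.

(** Positivity is what Perron's theorem asks of right multiplication by the sum of the basis. If [m]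
    is the index of a basis element occurring in the non-zero product of the dual of [b k] with
    [b j], the trace form shows that [b k] occurs in the product of [b j] with the dual of [b m]. *)
Lemma fcoord_mul_sum_gt0 j k : 0 < fcoord F k (b j * \sum_i b i).
Proof.
have /eqP bb := fmul_neq0 F (fdual F k) j.
have [m bm] : exists m, fcoord F m (b (fdual F k) * b j) != 0.
  apply: contrapT => h; apply: bb; rewrite [LHS](fbasisE F) big1// => m _.
  have [->|bm] := eqVneq (fcoord F m (b (fdual F k) * b j)) 0.
    by rewrite mulr0z.
  by case: h; exists m.
rewrite mulr_sumr fcoord_sum (bigD1 (fdual F m))//= ltr_pwDl//; last first.
  by apply: sumr_ge0 => i _; exact: fmul_ge0.
rewrite lt_neqAle fmul_ge0 andbT eq_sym fcoord_trace mulrA fcoord0_mulE.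
rewrite (bigD1 m)//= fcoord_basis eqxx mulr1 big1 ?addr0// => i im.
by rewrite fcoord_basis (inj_eq (can_inj (fdualK F))) (negbTE im) mulr0.
Qed.

(* A Perron eigenvector of right multiplication by the sum of the basis spans
   its eigenspace, which is stable under the commuting left multiplications. *)
Lemma exists_fusion_character : exists c : I -> RR,
  (forall i, 0 < c i) /\ monoid_morphism (basis_ext c).
Proof.
pose P := \sum_i b i.
pose A j k : RR := (fcoord F k (b j * P))%:~R.
have [|lam [d [d0 Ad]]] := @Perron_exists RR n A.
  by move=> j k; rewrite ltr0z fcoord_mul_sum_gt0.
have AE (f : R -> RR) j : {morph f : x y / x + y} ->
    \sum_k A j k * f (b k) = f (b j * P).
  by move=> fD; rewrite [RHS]morph_basis_ext.
have dP x : basis_ext d (x * P) = lam * basis_ext d x.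
  pose f := basis_ext d.
  have -> : basis_ext d (x * P) = \sum_j (fcoord F j x)%:~R * (f (b j * P)).
    rewrite [in LHS](fbasisE F x) mulr_suml raddf_sum /=; apply: eq_bigr => j _.
    by rewrite mulrzAl raddfMz /= mulrC mulrzr.
  rewrite mulr_sumr; apply: eq_bigr => j _.
  rewrite -AE; last exact: raddfD.
  rewrite mulrCA; congr (_ * _).
  rewrite -Ad; apply: eq_bigr => k _; by rewrite /f /= basis_ext_basis.
(* For fixed [i] the values of [d] on [b i * b k] form an eigenvector for the same [lam], hence a
   multiple of [d]; the entry at [ord0] gives the factor. *)
have key i j : basis_ext d (b i * b j) = d i * d j / d ord0.
  pose e k := basis_ext d (b i * b k).
  have Ae k : \sum_j A k j * e j = lam * e k.
    rewrite -dP -mulrA.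
    by apply: (AE (basis_ext d \o *%R (b i))) => x y /=; rewrite mulrDr raddfD.
  have [|t te] := Perron_simple _ d0 Ad Ae.
    by move=> p q; rewrite ltr0z fcoord_mul_sum_gt0.
  have := te ord0; rewrite /e fbasis0 mulr1 basis_ext_basis => ti.
  by rewrite -/(e j) te ti mulrAC mulfK// gt_eqF.
(* Rescaled so that the unit has value 1. *)
exists (fun i => d i / d ord0); split=> [i|]; first by rewrite divr_gt0.
have dE x : basis_ext (fun i => d i / d ord0) x = basis_ext d x / d ord0.
  by rewrite /basis_ext mulr_suml; apply: eq_bigr => i _; rewrite mulrA.
split=> [|x y]; first by rewrite dE -(fbasis0 F) basis_ext_basis divff// gt_eqF.
rewrite !dE.
have -> : basis_ext d (x * y) = \sum_i \sum_j
    (fcoord F i x)%:~R * (fcoord F j y)%:~R * basis_ext d (b i * b j).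
  rewrite [in LHS](fbasisE F x) mulr_suml raddf_sum /=; apply: eq_bigr => i _.
  rewrite [in LHS](fbasisE F y) mulr_sumr raddf_sum /=; apply: eq_bigr => j _.
  rewrite mulrzAl mulrzAr !raddfMz /= -[LHS]mulrzr -[X in X * _ = _]mulrzr; ring.
rewrite {2 3}/basis_ext [X in _ = X * _]mulr_suml [X in _ = _ * X]mulr_suml.
rewrite mulr_suml mulr_suml; apply: eq_bigr => i _.
rewrite mulr_suml mulr_sumr; apply: eq_bigr => j _.
rewrite key; field; by rewrite gt_eqF.
Qed.

(** [c] is a positive eigenvector of every fusion matrix, with eigenvalue [c j]. For any other
    eigenvalue [a >= 0] with row eigenvector [v], pairing the inequality between [a |v|] and [|v|]
    times the matrix with [c] gives [a <= c j]. *)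
Lemma FPdim_basis_character (c : I -> RR) : (forall i, 0 < c i) ->
  monoid_morphism (basis_ext c) -> FPdim_basis F RR =1 c.
Proof.
move=> c0 [_ cM] j.
have Nc k : \sum_l fusion_mx F RR j k l * c l = c j * c k.
  transitivity (basis_ext c (b j * b k)); last by rewrite cM !basis_ext_basis.
  by apply: eq_bigr => l _; rewrite mxE.
have eig : eigenvalue (fusion_mx F RR j) (c j).
  (* [eigenvalue] refers to row vectors while [c] is a column eigenvector; the transpose has the
     same rank. *)
  rewrite /eigenvalue /eigenspace kermx_eq0 /row_free -mxrank_tr.
  rewrite -[_ == _]/(row_free _) -kermx_eq0 linearB /= tr_scalar_mx.
  apply/eigenvalueP; exists (\row_k c k).
    apply/rowP => k; rewrite !mxE -Nc; apply: eq_bigr => l _.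
    by rewrite !mxE mulrC.
  by apply/eqP => /rowP/(_ ord0)/eqP; rewrite !mxE gt_eqF.
have ub : ubound [set a : RR | 0 <= a /\ eigenvalue (fusion_mx F RR j) a] (c j).
  move=> a /= [a0 /eigenvalueP[v va v0]].
  pose s := \sum_l `|v ord0 l| * c l.
  have s0 : 0 < s.
    have [k vk] : exists k, v ord0 k != 0.
      by apply: contrapT => h; case/eqP: v0; apply/rowP => k; rewrite mxE;
        apply/eqP/negP => /negP vk; apply: h; exists k.
    rewrite /s (bigD1 k)//= ltr_pwDl//; first by rewrite mulr_gt0// normr_gt0.
    by apply: sumr_ge0 => l _; rewrite mulr_ge0// ltW.
  rewrite -(ler_pM2r s0).
  have -> : c j * s = \sum_l (\sum_k `|v ord0 k| * fusion_mx F RR j k l) * c l.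
    under eq_bigr do rewrite mulr_suml.
    rewrite exchange_big /= mulr_sumr; apply: eq_bigr => k _.
    by rewrite mulrCA -Nc mulr_sumr; apply: eq_bigr => l _; rewrite mulrA.
  rewrite mulr_sumr; apply: ler_sum => l _; rewrite mulrA ler_pM2r//.
  have -> : a * `|v ord0 l| = `|(v *m fusion_mx F RR j) ord0 l|.
    by rewrite va mxE normrM (ger0_norm a0).
  rewrite mxE (le_trans (ler_norm_sum _ _ _))//; apply: ler_sum => k _.
  by rewrite normrM (ger0_norm (_ : 0 <= fusion_mx F RR j k l))// mxE ler0z fmul_ge0.
rewrite /FPdim_basis; apply/eqP; rewrite eq_le; apply/andP; split.
  by apply: ge_sup => //; exists (c j); split => //; exact: ltW.
by apply: ub_le_sup; [exists (c j)|split => //; exact: ltW].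
Qed.

Lemma FPdim_basis_gt0 j : 0 < FPdim_basis F RR j.
Proof.
by have [c [c0 cM]] := exists_fusion_character; rewrite (FPdim_basis_character c0 cM).
Qed.

Lemma FPdimD x y : FPdim F RR (x + y) = FPdim F RR x + FPdim F RR y.
Proof. exact: basis_extD. Qed.

Lemma FPdim_monoid_morphism : monoid_morphism (FPdim F RR).
Proof.
have [c [c0 cM]] := exists_fusion_character.
rewrite (_ : FPdim F RR = basis_ext c)//; apply/funext => x.
by apply: eq_bigr => i _; rewrite (FPdim_basis_character c0 cM).
Qed.

End FPdimMorphism.

(** * Roots of the unfolded system *)

Section Length.
Context {S : finType} (M : coxeter_matrix S).
Local Notation W := (coxeter_group M).
Local Notation gen := (coxeter_gen M).
Local Open Scope group_scope.

Lemma coxeter_class_cat u v :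
  coxeter_class M (u ++ v) = coxeter_class M u * coxeter_class M v.
Proof. by rewrite -coxeter_mulE. Qed.

Lemma coxeter_class_cons s u : coxeter_class M (s :: u) = gen s * coxeter_class M u.
Proof. exact: (coxeter_class_cat [:: s] u). Qed.

Lemma coxeter_class_prod u : coxeter_class M u = \prod_(s <- u) gen s.
Proof. by elim: u => [|s u IH]; rewrite ?big_nil// big_cons -IH coxeter_class_cons. Qed.

Lemma coxeter_ind (P : W -> Prop) : P 1 -> (forall s w, P w -> P (gen s * w)) ->
  forall w, P w.
Proof.
move=> P1 PM w; rewrite -[w]coxeter_wordK.
by elim: (coxeter_word w) => // s u IH; rewrite coxeter_class_cons; exact: PM.
Qed.

Lemma coxeter_genK s : gen s * gen s = 1.
Proof.
rewrite -[gen s]/(coxeter_class M [:: s]) -coxeter_class_cat.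
exact/coxeter_classP/coxeter_cong_ss.
Qed.

Lemma coxeter_genV s : (gen s)^-1 = gen s.
Proof. by apply: (mulgI (gen s)); rewrite mulgV coxeter_genK. Qed.

Lemma coxeter_mulK s w : w * gen s * gen s = w.
Proof. by rewrite -mulgA coxeter_genK mulg1. Qed.

Lemma coxeter_relation s t m : M s t = Some m ->
  coxeter_class M (flatten (nseq m [:: s; t])) = 1.
Proof. by move=> st; apply/coxeter_classP; exact: CoxRel. Qed.

Lemma coxeter_comm s t : M s t = Some 2%N -> gen s * gen t = gen t * gen s.
Proof.
move=> /coxeter_relation; rewrite coxeter_class_prod /= !big_cons big_nil mulg1 => st.
apply: (mulIg (gen s * gen t)); rewrite -!mulgA st.
by rewrite (mulgA (gen s) (gen s)) coxeter_genK mul1g coxeter_genK.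
Qed.

Lemma coxeter_braid s t : M s t = Some 3%N ->
  gen s * gen t * gen s = gen t * gen s * gen t.
Proof.
move=> /coxeter_relation; rewrite coxeter_class_prod /= !big_cons big_nil mulg1 => st.
apply: (mulIg (gen t * gen s * gen t)); rewrite -!mulgA st.
rewrite (mulgA (gen t) (gen t)) coxeter_genK mul1g.
by rewrite (mulgA (gen s) (gen s)) coxeter_genK mul1g coxeter_genK.
Qed.

Lemma exists_word (w : W) :
  exists k, [exists u : k.-tuple S, coxeter_class M u == w].
Proof.
exists (size (coxeter_word w)); apply/existsP.
by exists (in_tuple (coxeter_word w)); rewrite coxeter_wordK.
Qed.

Definition coxeter_len (w : W) : nat := ex_minn (exists_word w).
Local Notation len := coxeter_len.

Lemma coxeter_lenP w : exists2 u, coxeter_class M u = w & size u = len w.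
Proof.
rewrite /len; case: ex_minnP => k /existsP[u /eqP uw] _.
by exists u; rewrite ?size_tuple.
Qed.

Lemma coxeter_len_class u : (len (coxeter_class M u) <= size u)%N.
Proof.
rewrite /len; case: ex_minnP => k _; apply; apply/existsP.
by exists (in_tuple u).
Qed.

Lemma coxeter_len_mulr (w : W) s : (len (w * gen s)%g <= (len w).+1)%N.
Proof.
have [u <- <-] := coxeter_lenP w.
by rewrite -[gen s]/(coxeter_class M [:: s]) -coxeter_class_cat
  (leq_trans (coxeter_len_class _))// size_cat addn1.
Qed.

Lemma coxeter_len_mulr_ge (w : W) s : (len w <= (len (w * gen s)%g).+1)%N.
Proof. by rewrite -{1}(coxeter_mulK s w) coxeter_len_mulr. Qed.

(** Take the last letter of a shortest word. *)
Lemma coxeter_descent (w : W) : w <> 1 -> exists s, len w = (len (w * gen s)).+1.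
Proof.
have [u <-] := coxeter_lenP w; case/lastP: u => // u s.
rewrite size_rcons -cats1 coxeter_class_cat -[coxeter_class M [:: s]]/(gen s).
move=> us _; exists s; apply/eqP; rewrite eqn_leq coxeter_len_mulr_ge /=.
by rewrite -us coxeter_mulK ltnS coxeter_len_class.
Qed.

End Length.

(** * Positive and negative roots *)

Section RootSystem.
Context {RR : realType} {S : finType} {M : coxeter_matrix S} {R : nzRingType}
  {n : nat} {F : fusion_ring R n} (G : geometric_realisation RR M F).
Local Notation A := ('I_n.+1 * S)%type.
Local Notation V := (root_module S R).
Local Notation cW := (coxeter_group (unfolded_matrix G)).
Local Notation gen := (coxeter_gen (unfolded_matrix G)).
Local Notation len := (@coxeter_len _ (unfolded_matrix G)).
Local Notation croot := (@croot S R n F).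
Local Notation ccoord := (@ccoord S R n F).
Local Notation "w • v" := (unfolded_action G w v) (at level 40).

Lemma fnonnegM x y : fnonneg F x -> fnonneg F y -> fnonneg F (x * y).
Proof.
move=> x0 y0 i; rewrite (fbasisE F x) (fbasisE F y) mulr_suml fcoord_sum.
apply: sumr_ge0 => j _; rewrite mulr_sumr fcoord_sum; apply: sumr_ge0 => k _.
rewrite mulrzAl mulrzAr !fcoordMz; apply: mulr_ge0 => //; apply: mulr_ge0 => //.
exact: fmul_ge0.
Qed.

Lemma fnonneg_basis i : fnonneg F (fbasis F i).
Proof. by move=> j; rewrite fcoord_basis; case: eqP. Qed.

Lemma cform_le0 a c : a != c -> cform G a c <= 0.
Proof.
case: a c => [i s] [j t]; rewrite xpair_eqE /cform /= => ac.
case: (eqVneq s t) ac => [_|st] ac; first by rewrite andbT in ac; rewrite (negbTE ac).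
rewrite -oppr_ge0 -fcoordN -mulrN; apply: fnonnegM; first exact: fnonneg_basis.
exact: gform_nonpos.
Qed.

Lemma root_module_coordE (v : V) : v = \sum_a croot a *~ ccoord a v.
Proof.
apply/ffunP => t; rewrite sum_ffunE [LHS](fbasisE F).
rewrite (eq_bigr (fun a => croot (a.1, a.2) t *~ fcoord F a.1 (v a.2))); last first.
  by case=> i s _; rewrite ffunMzE.
rewrite -(pair_bigA _ (fun i s => croot (i, s) t *~ fcoord F i (v s))) /=.
apply: eq_bigr => i _; rewrite (bigD1 t)//= big1 ?addr0; last first.
  by move=> s st; rewrite /Defs.croot /simple_root !ffunE eq_sym (negbTE st) scaler0 mul0rz.
by rewrite /Defs.croot /simple_root !ffunE eqxx [_ *: _]mulr1.
Qed.

Lemma creflD a : {morph crefl G a : u v / u + v}.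
Proof. by move=> u v; rewrite /crefl cbilinDr mulrzDr opprD addrACA. Qed.

Lemma cact_gen a v : gen a • v = crefl G a v.
Proof. exact: coxeter_action_gen. Qed.

Lemma cactD w : {morph unfolded_action G w : u v / u + v}.
Proof.
move: w; apply: coxeter_ind => [u v|s w IH u v]; first by rewrite !act1.
by rewrite !actM !cact_gen IH creflD.
Qed.

Lemma cact0 w : w • 0 = 0.
Proof. by apply: (addrI (w • 0)); rewrite -cactD !addr0. Qed.

Lemma cactN w v : w • (- v) = - (w • v).
Proof. by apply/eqP; rewrite -addr_eq0 -cactD addNr cact0. Qed.

Lemma cactMz w v k : w • (v *~ k) = (w • v) *~ k.
Proof.
have Mn m : w • (v *+ m) = (w • v) *+ m.
  by elim: m => [|m IH]; [rewrite !mulr0n cact0|rewrite !mulrS cactD IH].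
by case: k => k; [exact: Mn|rewrite NegzE !mulrNz cactN -!pmulrn Mn].
Qed.

Lemma cactK w : cancel (unfolded_action G w) (unfolded_action G w^-1%g).
Proof. by move=> v; rewrite -actM mulVg act1. Qed.

Lemma cactVK w : cancel (unfolded_action G w^-1%g) (unfolded_action G w).
Proof. by move=> v; rewrite -actM mulgV act1. Qed.

Lemma cact_gen_root a : gen a • croot a = - croot a.
Proof.
rewrite cact_gen /crefl cbilin_root cform_diag -[X in _ *~ X]/(1 + 1).
by rewrite mulrzDr mulr1z opprD addrA subrr add0r.
Qed.

Lemma ccoordN a (v : V) : ccoord a (- v) = - ccoord a v.
Proof. by rewrite /Defs.ccoord ffunE fcoordN. Qed.

Lemma ccoordMz a (v : V) k : ccoord a (v *~ k) = ccoord a v * k.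
Proof. by rewrite /Defs.ccoord ffunMzE fcoordMz. Qed.

Definition cpos (v : V) := forall a, 0 <= ccoord a v.

Lemma cposD u v : cpos u -> cpos v -> cpos (u + v).
Proof. by move=> u0 v0 a; rewrite ccoordD addr_ge0. Qed.

Lemma cposMz v k : 0 <= k -> cpos v -> cpos (v *~ k).
Proof. by move=> k0 v0 a; rewrite ccoordMz mulr_ge0. Qed.

Lemma cpos_root a : cpos (croot a).
Proof. by move=> c; rewrite ccoord_root; case: eqP. Qed.

Lemma cpos_anti v : cpos v -> cpos (- v) -> v = 0.
Proof.
move=> v0 v0'; rewrite [LHS]root_module_coordE big1// => a _.
have -> : ccoord a v = 0; last by rewrite mulr0z.
by apply/eqP; rewrite eq_le v0 andbT -oppr_ge0 -ccoordN v0'.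
Qed.

Lemma croot_neq0 a : croot a != 0.
Proof.
apply/eqP => /(congr1 (ccoord a)); rewrite ccoord_root eqxx.
by rewrite /Defs.ccoord ffunE fcoord_0.
Qed.

Lemma cact_gen_comb c d (p q : int) :
  gen c • (croot c *~ p + croot d *~ q) =
  croot c *~ (- p - cform G c d * q) + croot d *~ q.
Proof.
have := crefl_comb G c d 0 p q.
by rewrite !add0r raddf0 oppr0 add0r -cact_gen.
Qed.

Lemma cform_cases c d : c != d ->
  [\/ cform G c d = 0, cform G c d = -1 | cform G c d <= - 2].
Proof.
move=> /cform_le0; have [->|c0] := eqVneq (cform G c d) 0; first by constructor 1.
have [->|c1] := eqVneq (cform G c d) (-1); first by constructor 2.
move=> c2; constructor 3; lia.
Qed.

(* The positive combinations in the second clause are those produced by a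
   pair of generators of infinite order; only they need the induction. *)
Lemma ascent_positive w :
  (forall c, (len w <= len (w * gen c)%g)%N -> cpos (w • croot c)) /\
  (forall c d p q, cform G c d <= - 2 -> 0 <= q <= p ->
     (len w <= len (w * gen c)%g)%N -> cpos (w • (croot c *~ p + croot d *~ q))).
Proof.
have [k] := ubnP (len w); elim: k w => // k IH w; rewrite ltnS => wk.
have first c : (len w <= len (w * gen c)%g)%N -> cpos (w • croot c).
  move=> wc; have [->|w1] := eqVneq w 1%g; first by rewrite act1; exact: cpos_root.
  have [d wd] := coxeter_descent (elimN eqP w1).
  have dc : d != c by apply/eqP => dc; move: wc; rewrite -dc wd ltnn.
  pose w' := (w * gen d)%g.
  have w'w : w = (w' * gen d)%g by rewrite coxeter_mulK.
  have w'd : (len w' <= len (w' * gen d)%g)%N by rewrite -w'w wd.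
  have lw' : (len w').+1 = len w by rewrite wd.
  have w'k : (len w' < k)%N by lia.
  have [IH1 IH2] := IH w' w'k.
  rewrite {1}w'w actM.
  have gdc : gen d • croot c = croot c + croot d *~ - cform G d c.
    have := cact_gen_comb d c 0 1.
    by rewrite mulr0z add0r mulr1z oppr0 add0r mulr1 addrC.
  have := cform_cases dc; rewrite gdc => -[] dcE.
  (* Label 2: [gen d] fixes [croot c], and commutation carries the ascent at [c] from [w] to
     [w']. *)
  - rewrite dcE oppr0 mulr0z addr0; apply: IH1.
    have := coxeter_len_mulr_ge (w * gen c)%g d.
    rewrite -mulgA coxeter_comm ?mulgA -/w'.
      by move=> h; rewrite -ltnS lw'; exact: leq_trans wc h.
    by rewrite /= /unfolded_label cform_sym eq_sym (negbTE dc) dcE eqxx.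
  - rewrite dcE opprK mulr1z.
    (* Label 3: if [w'] ascends at [c], both summands are positive. Otherwise the sum is
       [gen c • croot d], and the braid relation shows that the shorter [w''] ascends at [d]. *)
    have [w'c|w'c] := leqP (len w') (len (w' * gen c)%g).
      by rewrite cactD; apply: cposD; exact: IH1.
    have -> : croot c + croot d = gen c • croot d.
      have := cact_gen_comb c d 0 1.
      by rewrite mulr0z add0r mulr1z oppr0 add0r mulr1 cform_sym dcE opprK mulr1z => ->.
    rewrite -actM; set w'' := (w' * gen c)%g.
    have w''k : (len w'' < k)%N by rewrite /w''; lia.
    have [IH3 _] := IH w'' w''k.
    apply: IH3.
    have l1 := coxeter_len_mulr_ge (w * gen c * gen d)%g c.
    have l2 := coxeter_len_mulr_ge (w * gen c)%g d.
    have : (w * gen c * gen d * gen c = w'' * gen d)%g.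
      rewrite /w'' /w' -!mulgA; congr (_ * _)%g; rewrite !mulgA; apply: coxeter_braid.
      by rewrite /= /unfolded_label cform_sym eq_sym (negbTE dc) dcE.
    move=> e; rewrite e in l1.
    have l12 : (len (w * gen c)%g <= (len (w'' * gen d)%g).+2)%N.
      by apply: leq_trans l2 _; rewrite ltnS.
    have := leq_trans wc l12.
    by rewrite -lw' ltnS => h; rewrite -ltnS; exact: leq_trans w'c h.
  (* Infinite label: the second clause applies with coefficients [- cform G d c] and 1. *)
  - rewrite addrC -[croot c]mulr1z; apply: IH2 => //; lia.
split=> // c d p q cd /andP[q0 qp] wc.
have [wd|wd] := leqP (len w) (len (w * gen d)%g).
  rewrite cactD !cactMz; apply: cposD; apply: cposMz => //; [lia|exact: first|].
  exact: first.
pose w' := (w * gen d)%g.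
have w'w : w = (w' * gen d)%g by rewrite coxeter_mulK.
(* Reflecting in [d] exchanges the roles of the two roots: since [cform G c d <= - 2], the new
   coefficient of [croot d] is at least [2 p - q], hence at least [p]. *)
rewrite {1}w'w actM addrC cact_gen_comb.
have w'k : (len w' < k)%N by rewrite /w'; lia.
have [_ IH2] := IH w' w'k.
apply: IH2.
- by rewrite cform_sym.
- by rewrite cform_sym; apply/andP; split; nia.
- by rewrite -w'w ltnW.
Qed.

Lemma descent_negative w c : (len (w * gen c)%g < len w)%N -> cpos (- (w • croot c)).
Proof.
move=> wc; rewrite -{1}(coxeter_mulK c w) actM cact_gen_root cactN opprK.
by apply: (ascent_positive _).1; rewrite coxeter_mulK ltnW.
Qed.

Lemma root_sign w c : cpos (w • croot c) \/ cpos (- (w • croot c)).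
Proof.
have [wc|wc] := leqP (len w) (len (w * gen c)%g).
  by left; exact: (ascent_positive w).1.
by right; exact: descent_negative.
Qed.

(** At a descent [c] of [w] the root [w • croot c] would be both positive and negative. *)
Lemma positive_trivial w : (forall c, cpos (w • croot c)) -> w = 1%g.
Proof.
move=> wpos; apply: contrapT => /coxeter_descent[c wc].
have : w • croot c = 0 by apply: cpos_anti => //; apply: descent_negative; rewrite wc.
move=> /(congr1 (unfolded_action G w^-1%g)); rewrite cactK cact0 => /eqP.
by rewrite (negbTE (croot_neq0 c)).
Qed.

Lemma cact_faithful w : (forall v, w • v = v) -> w = 1%g.
Proof. by move=> w1; apply: positive_trivial => c; rewrite w1; exact: cpos_root. Qed.

Definition croots : set V := [set v | exists w c, v = w • croot c].

Lemma cact_croots w v : croots v -> croots (w • v).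
Proof. by move=> [w' [c ->]]; exists (w * w')%g, c; rewrite actM. Qed.

Lemma croots_sign v : croots v -> cpos v \/ cpos (- v).
Proof. by move=> [w [c ->]]; exact: root_sign. Qed.

Lemma croots_neq0 v : croots v -> v != 0.
Proof.
move=> [w [c ->]]; apply/eqP => /(congr1 (unfolded_action G w^-1%g)).
by rewrite cactK cact0; exact/eqP/croot_neq0.
Qed.

(** Roots are primitive vectors: moving the multiple back to a simple root exhibits 1 as a multiple
    of [k]. *)
Lemma croots_multiple c k : croots (croot c *~ k) -> 0 <= k -> k = 1.
Proof.
move=> [w [d]] e k0; have : (w^-1%g • croot c) *~ k = croot d.
  by rewrite -cactMz e cactK.
move=> /(congr1 (ccoord d)); rewrite ccoordMz ccoord_root eqxx => dk.
have : (k %| 1)%Z by apply/dvdzP; exists (ccoord d (w^-1%g • croot c)).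
by rewrite dvdz1; lia.
Qed.

End RootSystem.

(** * The unfolding homomorphism *)

Section Unfold.
Context {RR : realType} {S : finType} {M : coxeter_matrix S} {R : nzRingType}
  {n : nat} {F : fusion_ring R n} (G : geometric_realisation RR M F).
Local Notation A := ('I_n.+1 * S)%type.
Local Notation V := (root_module S R).
Local Notation cgen := (coxeter_gen (unfolded_matrix G)).
Local Notation croot := (@croot S R n F).
Local Notation ccoord := (@ccoord S R n F).
Local Notation "w • v" := (unfolded_action G w v) (at level 40).
Local Notation gens s := (\prod_(i < n.+1) cgen (i, s))%g.

Lemma fstar0 : fstar F 0 = 0.
Proof. by rewrite /fstar big1// => i _; rewrite fcoord_0 mulr0z. Qed.

Lemma fstar1 : fstar F 1 = 1.
Proof. by rewrite -(fbasis0 F) fstar_basis fdual0. Qed.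

Lemma form_simple_root s (v : V) :
  Defs.form F (gform G) (simple_root R s) v = \sum_t v t * gform G s t.
Proof.
rewrite /Defs.form (bigD1 s)//= [X in _ + X]big1 ?addr0; last first.
  by move=> t ts; rewrite big1// => t' _; rewrite ffunE (negbTE ts) fstar0 mulr0.
by apply: eq_bigr => t _; rewrite ffunE eqxx fstar1 mulr1.
Qed.

(** This ties the two actions together: the reflection [s] subtracts, for all [i] at once, the terms
    of the reflections in [(i, s)]. *)
Lemma fcoord_form i s (v : V) :
  fcoord F i (Defs.form F (gform G) (simple_root R s) v) = cbilin G (croot (i, s)) v.
Proof.
rewrite form_simple_root cbilin_rootl fcoord_sum.
rewrite (eq_bigr (fun a => cform G (i, s) (a.1, a.2) * ccoord (a.1, a.2) v));
  last by case.
rewrite -(pair_bigA _ (fun j t => cform G (i, s) (j, t) * ccoord (j, t) v)) /=.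
rewrite exchange_big /=; apply: eq_bigr => t _.
rewrite {1}(fbasisE F (v t)) mulr_suml fcoord_sum; apply: eq_bigr => j _.
rewrite mulrzAl fcoordMz; congr (_ * _); rewrite /cform /=.
case: eqVneq => [->|//]; rewrite gform_diag mulr_natr mulr2n fcoordD fcoord_basis.
by case: eqP.
Qed.

Lemma gact_gen_sum s (v : V) : gact G (coxeter_gen M s) v =
  v - \sum_(i < n.+1) croot (i, s) *~ cbilin G (croot (i, s)) v.
Proof.
rewrite gact_gen; congr (_ - _).
rewrite [in LHS](fbasisE F (Defs.form _ _ _ _)) scaler_suml; apply: eq_bigr => i _.
by rewrite fcoord_form scalerMzl.
Qed.

(** The roots over one [s] are pairwise orthogonal, so no reflection changes the coefficient that
    another one subtracts. *)
Lemma cact_prod_gen (l : seq 'I_n.+1) s v : uniq l ->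
  (\prod_(i <- l) cgen (i, s))%g • v =
  v - \sum_(i <- l) croot (i, s) *~ cbilin G (croot (i, s)) v.
Proof.
elim: l => [_|j l IH]; first by rewrite !big_nil act1 subr0.
rewrite cons_uniq => /andP[jl ul].
set w := (\sum_(i <- l) _) in IH *.
have w0 : cbilin G (croot (j, s)) w = 0.
  rewrite raddf_sum; apply: big1_seq => i /andP[_ il].
  rewrite [LHS]raddfMz [X in X *~ _](cbilin_root G (j, s) (i, s)) /cform /= eqxx.
  by case: eqP => [ji|_]; [rewrite ji il in jl|rewrite mul0rz].
rewrite !big_cons actM IH// cact_gen /crefl -/w.
have -> : cbilin G (croot (j, s)) (v - w) = cbilin G (croot (j, s)) v.
  by rewrite [LHS]raddfB [X in _ - X]w0 subr0.
by rewrite opprD addrA addrAC.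
Qed.

Lemma gact_gen_prod s v : gact G (coxeter_gen M s) v = gens s • v.
Proof. by rewrite gact_gen_sum -cact_prod_gen// index_enum_uniq. Qed.

Lemma gact_class u v :
  gact G (coxeter_class M u) v = (\prod_(s <- u) gens s)%g • v.
Proof.
elim: u v => [|s u IH] v; first by rewrite big_nil !act1.
by rewrite big_cons coxeter_class_cons !actM IH gact_gen_prod.
Qed.

(* By faithfulness of the unfolded action phi respects the relations of W. *)
Lemma unfolding_class u :
  unfolding G (coxeter_class M u) = (\prod_(s <- u) gens s)%g.
Proof.
rewrite /unfolding /coxeter_lift; set w := coxeter_word _.
apply: (mulIg (\prod_(s <- u) gens s)^-1%g); rewrite mulgV; apply: cact_faithful => v.
by rewrite actM -gact_class coxeter_wordK gact_class cactVK.
Qed.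

Lemma unfolding_gen s : unfolding G (coxeter_gen M s) = gens s.
Proof. by rewrite unfolding_class big_seq1. Qed.

Lemma unfolding_morphism : monoid.monoid_morphism (unfolding G).
Proof.
split=> [|w w']; first by rewrite unfolding_class big_nil.
rewrite -[w]coxeter_wordK -[w']coxeter_wordK -coxeter_class_cat !unfolding_class.
by rewrite big_cat.
Qed.

Lemma unfolding_act w v : unfolding G w • v = gact G w v.
Proof. by rewrite -[w]coxeter_wordK unfolding_class gact_class. Qed.

End Unfold.

(** * Dominance *)

Section Dominance.
Context {RR : realType} {S : finType} {M : coxeter_matrix S} {R : nzRingType}
  {n : nat} {F : fusion_ring R n} (G : geometric_realisation RR M F).
Local Notation A := ('I_n.+1 * S)%type.
Local Notation V := (root_module S R).
Local Notation cgen := (coxeter_gen (unfolded_matrix G)).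
Local Notation croot := (@croot S R n F).
Local Notation ccoord := (@ccoord S R n F).
Local Notation cTheta := (@cTheta RR S R).
Local Notation cpos := (@cpos S R n F).
Local Notation "w • v" := (unfolded_action G w v) (at level 40).
Implicit Types (Z Y : V -> RR).

Lemma cTheta_nmod Z : cTheta Z -> nmod_morphism Z.
Proof.
by move=> ZD; split=> //; apply: (addrI (Z 0)); rewrite -ZD !addr0.
Qed.

Lemma cTheta0 Z : cTheta Z -> Z 0 = 0.
Proof. by case/cTheta_nmod. Qed.

Lemma cThetaN Z v : cTheta Z -> Z (- v) = - Z v.
Proof.
by move=> ZD; apply/eqP; rewrite -addr_eq0 -ZD addNr cTheta0.
Qed.

Lemma cTheta_coordE Z v : cTheta Z ->
  Z v = \sum_a (ccoord a v)%:~R * Z (croot a).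
Proof.
move=> ZD; pose z : {additive V -> RR} :=
  HB.pack Z (GRing.isNmodMorphism.Build V RR Z (cTheta_nmod ZD)).
rewrite -[Z]/(z : V -> RR) {1}(root_module_coordE (F := F) v) raddf_sum.
by apply: eq_bigr => a _; rewrite raddfMz mulrC mulrzr.
Qed.

Lemma cTheta_act Z w : cTheta Z -> cTheta (Z \o unfolded_action G w).
Proof. by move=> ZD u v /=; rewrite cactD ZD. Qed.

Definition dominant Z := forall a, 0 <= Z (croot a).
Definition strictly_dominant Z := forall a, 0 < Z (croot a).

Lemma dominant_ge0 Z v : cTheta Z -> dominant Z -> cpos v -> 0 <= Z v.
Proof.
move=> ZD Zd v0; rewrite cTheta_coordE//; apply: sumr_ge0 => a _.
by rewrite mulr_ge0// ler0z.
Qed.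

Lemma cpos_coord_gt0 v : cpos v -> v != 0 -> exists a, 0 < ccoord a v.
Proof.
move=> v0 vn0; apply: contrapT => h; case/eqP: vn0.
rewrite [LHS](root_module_coordE (F := F)) big1// => a _.
suff -> : ccoord a v = 0 by rewrite mulr0z.
apply/eqP; rewrite eq_le v0 andbT leNgt; apply/negP => va; by apply: h; exists a.
Qed.

Lemma strictly_dominant_gt0 Z v : cTheta Z -> strictly_dominant Z ->
  cpos v -> v != 0 -> 0 < Z v.
Proof.
move=> ZD Zd v0 /(cpos_coord_gt0 v0)[a va].
rewrite cTheta_coordE// (bigD1 a)//= ltr_pwDl//; first by rewrite mulr_gt0// ltr0z.
by apply: sumr_ge0 => c _; rewrite mulr_ge0 ?ler0z// ltW.
Qed.

Lemma strictly_dominant_cpos Y v : cTheta Y -> strictly_dominant Y ->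
  cpos v \/ cpos (- v) -> 0 <= Y v -> cpos v.
Proof.
move=> YD Yd [//|v0] Yv.
have [->|vn0] := eqVneq v 0.
  by move=> a; rewrite /Defs.ccoord ffunE fcoord_0.
have := strictly_dominant_gt0 YD Yd v0; rewrite oppr_eq0 => /(_ vn0).
by rewrite cThetaN// oppr_gt0 ltNge Yv.
Qed.

(* Such a finite list exists exactly when [Z] lies in the orbit of the closed
   chamber. *)
Definition neg_cover Z (r : seq V) :=
  forall v, croots G v -> cpos v -> Z v < 0 -> v \in r.

Section Abstract.
Context {X : finType} (f : X -> V -> V) (alpha : X -> V) (J : pred X).
Variable T : set (V -> RR).
Hypothesis fK : forall x, involutive (f x).
Hypothesis f_croots : forall x v, croots G v -> croots G (f x v).
Hypothesis alpha_croot : forall x, croots G (alpha x).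
Hypothesis alpha_pos : forall x, cpos (alpha x).
Hypothesis f_alpha : forall x, f x (alpha x) = - alpha x.
Hypothesis T_f : forall x Z, T Z -> T (Z \o f x).
Hypothesis f_pos : forall x Z v, T Z -> Z (alpha x) < 0 ->
  croots G v -> cpos v -> Z (f x v) < 0 -> cpos (f x v).

(** Reflect in a simple root with negative value until none is left; each step shortens the covering
    list by one. The hypotheses on [f] cover both the unfolded group on [cTheta] and [W] on [Theta].
    A generator of [W] may negate several positive roots, hence the conditional form of [f_pos]. The
    predicate [J] restricts to the generators that fix a given face. *)
Lemma dominate Z r : T Z -> neg_cover Z r ->
  exists u : seq X, [/\ all J u, (size u <= size r)%N &
    forall x, J x -> 0 <= Z (foldr f (alpha x) u)].
Proof.
have [k] := ubnP (size r); elim: k Z r => // k IH Z r; rewrite ltnS => rk TZ Zr.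
have [Zpos|/existsNP[x /not_implyP[Jx /negP]]] :=
  pselect (forall x, J x -> 0 <= Z (alpha x)); first by exists [::].
rewrite -ltNge => Zx.
have xr : alpha x \in r by exact: Zr.
(* The root [alpha x] leaves the list, since [f x] makes it negative; by [f_pos] every positive root
   negative under the new functional comes from one still listed. *)
pose r' := map (f x) (rem (alpha x) r).
have rr : (size r').+1 = size r.
  by rewrite size_map size_rem// prednK//; case: (r) xr.
have Zr' : neg_cover (Z \o f x) r'.
  move=> v rv v0 /= Zv; rewrite -[v](fK x); apply: map_f; apply: rem_mem.
    apply/eqP => e; have v_neg : cpos (- v) by rewrite -[v](fK x) e f_alpha opprK.
    by have := croots_neq0 rv; rewrite (cpos_anti v0 v_neg) eqxx.
  by apply: Zr => //; [exact: f_croots|exact: (f_pos TZ)].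
have [|u [Ju ur Zu]] := IH _ _ _ (T_f x TZ) Zr'; first by lia.
exists (x :: u); split => /=; [by rewrite Jx|lia|exact: Zu].
Qed.
End Abstract.

Lemma ccoord_crefl a c v : c != a -> ccoord c (cgen a • v) = ccoord c v.
Proof.
move=> ca; rewrite cact_gen /crefl ccoordD ccoordN ccoordMz ccoord_root.
by rewrite (negbTE ca) mul0r oppr0 addr0.
Qed.

Lemma cgenK a : involutive (unfolded_action G (cgen a)).
Proof. by move=> v; rewrite -actM coxeter_genK act1. Qed.

Lemma supported_root a v : (forall c, c != a -> ccoord c v = 0) ->
  v = croot a *~ ccoord a v.
Proof.
move=> h; rewrite [LHS](root_module_coordE (F := F)) (bigD1 a)//= big1 ?addr0//.
by move=> c ca; rewrite h// mulr0z.
Qed.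

(** The reflection changes only the coordinate at [a], so the other coordinates of [v] vanish, and a
    positive multiple of a simple root is a root only if it is simple. *)
Lemma cgen_neg_root a v : croots G v -> cpos v -> ~ cpos (cgen a • v) -> v = croot a.
Proof.
move=> rv v0; have [//|nv _] := croots_sign (cact_croots (cgen a) rv).
have va : v = croot a *~ ccoord a v.
  apply: supported_root => c ca; apply/eqP; rewrite eq_le v0 andbT.
  by rewrite -(ccoord_crefl v ca) -oppr_ge0 -ccoordN.
have := rv; rewrite va => /croots_multiple-> //.
Qed.

Lemma foldr_cact u v : foldr (fun a => unfolded_action G (cgen a)) v u =
  coxeter_class (unfolded_matrix G) u • v.
Proof.
by elim: u => [|a u IH]; rewrite ?act1//= IH coxeter_class_cons actM.
Qed.

Lemma croots_root a : croots G (croot a).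
Proof. by exists 1%g, a; rewrite act1. Qed.

Lemma cW_dominate (J : pred A) Z r : cTheta Z -> neg_cover Z r ->
  exists u : seq A, [/\ all J u, (size u <= size r)%N &
    forall a, J a -> 0 <= Z (coxeter_class (unfolded_matrix G) u • croot a)].
Proof.
move=> ZD Zr.
have [|||||||u [Ju ur Zu]] := @dominate _ (fun a => unfolded_action G (cgen a)) croot J
  cTheta _ _ _ _ _ _ _ Z r ZD Zr.
- exact: cgenK.
- by move=> a v; exact: cact_croots.
- exact: croots_root.
- by move=> a; exact: cpos_root.
- by move=> a; exact: cact_gen_root.
- by move=> a Y; exact: cTheta_act.
- move=> a Y v YD Ya rv v0 Yv; apply: contrapT => nv.
  have := cgen_neg_root rv v0 nv => va.
  by move: Yv; rewrite va cact_gen_root cThetaN// oppr_lt0 ltNge ltW.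
exists u; split => // a Ja; rewrite -foldr_cact; exact: Zu.
Qed.

(** A generator [a] on the left of [w] adds at most the inversion [w^-1 • croot a]. *)
Lemma inversions_finite w : exists r : seq V,
  forall v, croots G v -> cpos v -> ~ cpos (w • v) -> v \in r.
Proof.
move: w; apply: coxeter_ind => [|a w [r rP]]; first by exists [::] => v; rewrite act1.
exists (w^-1%g • croot a :: r) => v rv v0; rewrite actM => nv.
have [wv|wv] := pselect (cpos (w • v)); last by rewrite inE rP ?orbT.
by rewrite inE -(cgen_neg_root (cact_croots w rv) wv nv) cactK eqxx.
Qed.

Definition neg_finite Z := exists r, neg_cover Z r.

Lemma dominant_neg_finite Z : cTheta Z -> dominant Z -> neg_finite Z.
Proof.
by move=> ZD Zd; exists [::] => v _ v0; rewrite ltNge dominant_ge0.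
Qed.

(** A positive root negative under the translate is either an inversion of [w] or carried by [w]
    into the list for [Z]. *)
Lemma neg_finite_act Z w : cTheta Z -> neg_finite Z ->
  neg_finite (Z \o unfolded_action G w).
Proof.
move=> ZD [r rP]; have [r' r'P] := inversions_finite w.
exists (r' ++ map (unfolded_action G w^-1%g) r) => v rv v0 /= Zv.
rewrite mem_cat; have [wv|/r'P->//] := pselect (cpos (w • v)).
rewrite -[v](cactK w) [X in _ || X]map_f ?orbT//; apply: rP => //.
exact: cact_croots.
Qed.

Lemma neg_finite_le Z Y : cTheta Z -> cTheta Y ->
  (forall a, Z (croot a) <= Y (croot a)) -> neg_finite Z -> neg_finite Y.
Proof.
move=> ZD YD ZY [r rP]; exists r => v rv v0 Yv; apply: rP => //.
apply: le_lt_trans Yv; rewrite !(cTheta_coordE v)//; apply: ler_sum => a _.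
by rewrite ler_wpM2l// ler0z.
Qed.

Lemma croots_opp v : croots G v -> croots G (- v).
Proof.
by move=> [w [a ->]]; exists (w * cgen a)%g, a; rewrite actM cact_gen_root cactN.
Qed.

(* The inversions of [w] are the positive roots on which the translate
   [Y \o w] of an interior point of the chamber is negative. *)
Lemma inversions_word Y w (r : seq V) : cTheta Y -> strictly_dominant Y ->
  (forall v, croots G v -> cpos v -> ~ cpos (w • v) -> v \in r) ->
  exists2 u, (size u <= size r)%N & w = coxeter_class (unfolded_matrix G) u.
Proof.
move=> YD Yd rP.
have [|u [_ ur Yu]] :=
  @cW_dominate predT (Y \o unfolded_action G w) r (cTheta_act w YD).
  move=> v rv v0 /= Yv; apply: rP => // wv; move: Yv.
  by rewrite ltNge dominant_ge0// => a; exact: ltW.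
exists (rev u); first by rewrite size_rev.
(* With [u] making [Y \o w] dominant, [w] times the class of [u] maps simple roots to roots on which
   [Y] is non-negative, hence to positive ones, and so is trivial. *)
apply: (mulIg (coxeter_class (unfolded_matrix G) u)).
rewrite -coxeter_class_cat.
have -> : coxeter_class (unfolded_matrix G) (rev u ++ u) = 1%g.
  by apply/coxeter_classP; exact: coxeter_cong_rev.
apply: (@positive_trivial _ _ _ _ _ _ G) => c; rewrite actM.
apply: (strictly_dominant_cpos YD Yd); last exact: Yu.
by apply: croots_sign; do 2 apply: cact_croots; exact: croots_root.
Qed.

(** A vanishing sum of non-negative terms vanishes termwise. For [Z1] this confines the support of
    [v] to simple roots killed by [Z1], on which [Z2] is non-negative, and the argument repeats for
    [Z2]. *)
Lemma face_ge0 Z1 Z2 v : cTheta Z1 -> cTheta Z2 -> dominant Z1 ->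
  (forall a, Z1 (croot a) = 0 -> 0 <= Z2 (croot a)) -> cpos v -> Z1 v = 0 ->
  0 <= Z2 v /\ forall a, ccoord a v != 0 ->
    Z1 (croot a) = 0 /\ (Z2 v = 0 -> Z2 (croot a) = 0).
Proof.
move=> Z1D Z2D Z1d Z12 v0; rewrite (cTheta_coordE v Z1D) => /eqP.
rewrite psumr_eq0 => [/allP z1|a _]; last by rewrite mulr_ge0// ler0z.
have Z1a a : ccoord a v != 0 -> Z1 (croot a) = 0.
  move=> va; have := z1 a (mem_index_enum a).
  by rewrite /= mulf_eq0 intr_eq0 (negbTE va) => /eqP.
have Z2a a : 0 <= (ccoord a v)%:~R * Z2 (croot a).
  have [->|va] := eqVneq (ccoord a v) 0; first by rewrite mul0r.
  by rewrite mulr_ge0 ?ler0z// Z12// Z1a.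
rewrite (cTheta_coordE v Z2D); split=> [|a va]; first exact: sumr_ge0.
split; first exact: Z1a.
move=> /eqP; rewrite psumr_eq0// => /allP z2; have := z2 a (mem_index_enum a).
by rewrite /= mulf_eq0 intr_eq0 (negbTE va) => /eqP.
Qed.

Lemma face_word Z u : cTheta Z -> all (fun a => Z (croot a) == 0) u ->
  forall v, Z (coxeter_class (unfolded_matrix G) u • v) = Z v.
Proof.
move=> ZD; elim: u => [_ v|a u IH /= /andP[/eqP Za Zu] v]; first by rewrite act1.
rewrite coxeter_class_cons actM cact_gen /crefl ZD cThetaN//.
set k := cbilin _ _ _; have -> : Z (croot a *~ k) = 0.
  rewrite (cTheta_coordE _ ZD) big1// => c _; rewrite ccoordMz ccoord_root.
  by case: eqP => [->|]; rewrite ?Za ?mulr0// mul0r mul0r.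
by rewrite oppr0 addr0 IH.
Qed.

(* Moving Z1 into the chamber and then Z2 into the chamber of the stabiliser of
   Z1 reduces to simple reflections. *)
Lemma common_stabiliser Z1 Z2 w : cTheta Z1 -> cTheta Z2 ->
  neg_finite Z1 -> neg_finite Z2 ->
  (forall v, Z1 (w • v) = Z1 v) -> (forall v, Z2 (w • v) = Z2 v) ->
  (forall v, croots G v -> Z1 v = 0 -> Z2 v = 0 -> False) -> w = 1%g.
Proof.
move=> Z1D Z2D [r1 Z1r] Z2f wZ1 wZ2 noroot.
have [u1 [_ _ Z1d]] := cW_dominate predT Z1D Z1r.
set x := coxeter_class _ u1 in Z1d.
pose Y1 := Z1 \o unfolded_action G x; pose Y2 := Z2 \o unfolded_action G x.
have Y1D : cTheta Y1 by exact: cTheta_act.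
have Y2D : cTheta Y2 by exact: cTheta_act.
have [r2 Y2r] : neg_finite Y2 by exact: neg_finite_act.
have [u2 [Ju2 _ Y2d]] := cW_dominate (fun a => Y1 (croot a) == 0) Y2D Y2r.
set y := coxeter_class _ u2 in Y2d.
have Y1y v : Y1 (y • v) = Y1 v by exact: face_word.
pose w' := ((x * y)^-1 * w * (x * y))%g.
apply: contrapT => w1.
have w'1 : w' <> 1%g.
  move=> e; apply: w1; apply: (mulgI (x * y)^-1%g); apply: (mulIg (x * y)%g).
  by rewrite mulg1 mulVg.
(* The conjugate [w'] fixes both translated functionals but makes [croot a] negative; so each of
   them, being non-negative on [croot a] and on the negated image, vanishes there, first [Y1] and
   then [Y2] translated by [y]. *)
have [a wa] := coxeter_descent w'1.
have na : cpos (- (w' • croot a)) by apply: descent_negative; rewrite wa.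
have xyw' v : x • (y • (w' • v)) = w • (x • (y • v)).
  by rewrite -!actM /w' !mulgA mulgV mul1g.
have E1 v : Y1 (w' • v) = Y1 v.
  by rewrite -[in RHS]Y1y -[in LHS]Y1y /Y1 /= xyw' wZ1.
have E2 v : Y2 (y • (w' • v)) = Y2 (y • v) by rewrite /Y2 /= xyw' wZ2.
have Y1a : Y1 (croot a) = 0.
  apply/eqP; rewrite eq_le Z1d// andbT -E1 -oppr_ge0 -cThetaN//.
  by apply: dominant_ge0 => // c; exact: Z1d.
have [|||Y2na _] := @face_ge0 Y1 (Y2 \o unfolded_action G y) (- (w' • croot a)) Y1D
  (cTheta_act y Y2D) _ _ na.
- by move=> c; exact: Z1d.
- by move=> c Y1c; apply: Y2d; apply/eqP.
- by rewrite cThetaN// E1 Y1a oppr0.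
have Y2a : Y2 (y • croot a) = 0.
  apply/eqP; rewrite eq_le Y2d ?Y1a// andbT -E2 -oppr_ge0 -cThetaN//.
  by rewrite -cactN.
apply: (noroot (x • (y • croot a))) => //.
  by do 2 apply: cact_croots; exact: croots_root.
by rewrite -[LHS]/(Y1 (y • croot a)) Y1y.
Qed.

End Dominance.

(** * Dominance in [Theta] under [W] *)

Section RealisationDominance.
Context {RR : realType} {S : finType} {M : coxeter_matrix S} {R : nzRingType}
  {n : nat} {F : fusion_ring R n} (G : geometric_realisation RR M F).
Local Notation V := (root_module S R).
Local Notation gen := (coxeter_gen M).
Local Notation croot := (@croot S R n F).
Local Notation ccoord := (@ccoord S R n F).
Local Notation cTheta := (@cTheta RR S R).
Local Notation Theta := (@Theta RR S R n F).
Local Notation cpos := (@cpos S R n F).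
Local Notation alpha := (simple_root R).
Implicit Types (Z : V -> RR).

Lemma simple_root_croot s : alpha s = croot (ord0, s).
Proof. by rewrite /Defs.croot /= fbasis0 scale1r. Qed.

Lemma Theta_croot Z a : Theta Z -> Z (croot a) = FPdim_basis F RR a.1 * Z (alpha a.2).
Proof. by move=> [_ ->]; rewrite [FPdim _ _ _]basis_ext_basis. Qed.

Lemma Theta_dominant Z : Theta Z -> (forall s, 0 <= Z (alpha s)) -> dominant (F := F) Z.
Proof. by move=> ZT Zd a; rewrite Theta_croot// mulr_ge0// ltW// FPdim_basis_gt0. Qed.

Lemma Theta_strictly_dominant Z : Theta Z -> (forall s, 0 < Z (alpha s)) ->
  strictly_dominant (F := F) Z.
Proof. by move=> ZT Zd a; rewrite Theta_croot// mulr_gt0// FPdim_basis_gt0. Qed.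

(** A point of [Theta] in the open chambers of both groups. It serves as the direction in which
    interiors are tested. *)
Definition weyl_vector (v : V) : RR := \sum_t FPdim F RR (v t).

Lemma weyl_vector_Theta : Theta weyl_vector.
Proof.
split=> [u v|r v].
  by rewrite -big_split; apply: eq_bigr => t _; rewrite ffunE FPdimD.
rewrite mulr_sumr; apply: eq_bigr => t _; rewrite ffunE.
by have [_ FM] := FPdim_monoid_morphism (RR := RR) F; rewrite [_ *: _]/(r * v t) FM.
Qed.

Lemma weyl_vector_root s : weyl_vector (alpha s) = 1.
Proof.
have [F1 _] := FPdim_monoid_morphism (RR := RR) F.
rewrite /weyl_vector (bigD1 s)//= ffunE eqxx F1 big1 ?addr0// => t ts.
rewrite ffunE (negbTE ts) /FPdim big1// => i _.
by rewrite fcoord_0 mul0r.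
Qed.

Lemma weyl_vector_dominant : strictly_dominant (F := F) weyl_vector.
Proof.
apply: (Theta_strictly_dominant weyl_vector_Theta) => s.
by rewrite weyl_vector_root.
Qed.

Lemma gactD w : {morph gact G w : u v / u + v}.
Proof. by move=> u v; have := gact_linear G w 1 u v; rewrite !scale1r. Qed.

Lemma gactZ w r v : gact G w (r *: v) = r *: gact G w v.
Proof.
have g0 : gact G w 0 = 0 by apply: (addrI (gact G w 0)); rewrite -gactD !addr0.
by have := gact_linear G w r v 0; rewrite g0 !addr0.
Qed.

Lemma Theta_gact w Z : Theta Z -> Theta (Z \o gact G w).
Proof.
by move=> [ZD ZF]; split=> [u v|r v] /=; [rewrite gactD ZD|rewrite gactZ ZF].
Qed.

Lemma croots_gact w v : croots G v -> croots G (gact G w v).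
Proof. by rewrite -unfolding_act; exact: cact_croots. Qed.

Lemma ggenK s : involutive (gact G (gen s)).
Proof. by move=> v; rewrite -actM coxeter_genK act1. Qed.

Lemma supported_simple_root s (v : V) :
  (forall t, t != s -> v t = 0) -> v = v s *: alpha s.
Proof.
move=> vs; apply/ffunP => t; rewrite !ffunE; case: eqVneq => [->|/vs->].
  by rewrite [_ *: _]mulr1.
by rewrite scaler0.
Qed.

Lemma gact_gen_supported s (v : V) :
  (forall t, t != s -> v t = 0) -> gact G (gen s) v = - v.
Proof.
move=> vs; have vE := supported_simple_root vs; rewrite gact_gen form_simple_root (bigD1 s)//= big1 ?addr0; last first.
  by move=> t /vs ->; rewrite mul0r.
by rewrite gform_diag mulr_natr mulr2n scalerDl -vE opprD addrA subrr add0r.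
Qed.

Lemma gact_gen_root s : gact G (gen s) (alpha s) = - alpha s.
Proof. by apply: gact_gen_supported => t ts; rewrite ffunE (negbTE ts). Qed.

Lemma gact_gen_off s t (v : V) : t != s -> gact G (gen s) v t = v t.
Proof.
by move=> ts; rewrite gact_gen !ffunE (negbTE ts) scaler0 subr0.
Qed.

Lemma foldr_gact u v :
  foldr (fun s => gact G (gen s)) v u = gact G (coxeter_class M u) v.
Proof.
by elim: u => [|s u IH]; rewrite ?act1//= IH coxeter_class_cons actM.
Qed.

Lemma W_dominate (J : pred S) Z r : Theta Z -> neg_cover G Z r ->
  exists2 u : seq S, all J u &
    forall s, J s -> 0 <= Z (gact G (coxeter_class M u) (alpha s)).
Proof.
move=> ZT Zr.
have [|||||||u [Ju _ Zu]] := @dominate _ _ _ _ _ _ G _ (fun s => gact G (gen s)) alpha J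
  Theta _ _ _ _ _ _ _ Z r ZT Zr.
- exact: ggenK.
- by move=> s v; exact: croots_gact.
- by move=> s; rewrite simple_root_croot; exact: croots_root.
- by move=> s; rewrite simple_root_croot; exact: cpos_root.
- exact: gact_gen_root.
- by move=> s Y; exact: Theta_gact.
- move=> s Y v YT Ys rv v0 Yv.
  (* The generator [s] alters only the component at [s], so a root whose sign it changes lies in
     [R alpha_s]. There [s] acts as -1 and [Y] has the sign of its value at [alpha_s], so the new
     value cannot be negative. *)
  have [//|nv] := croots_sign (croots_gact (gen s) rv).
  have vs t : t != s -> v t = 0.
    move=> ts; rewrite [LHS](fbasisE F) big1// => i _.
    suff -> : fcoord F i (v t) = 0 by rewrite mulr0z.
    apply/eqP; rewrite eq_le; apply/andP; split; last exact: (v0 (i, t)).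
    by have := nv (i, t); rewrite ccoordN oppr_ge0 /Defs.ccoord /= gact_gen_off.
  move: Yv; rewrite (gact_gen_supported vs) cThetaN; last by case: YT.
  rewrite oppr_lt0 ltNge; case/negP.
  rewrite (supported_simple_root vs); case: YT => _ ->; apply: mulr_ge0_le0; last exact: ltW.
  apply: sumr_ge0 => i _; apply: mulr_ge0; first by rewrite ler0z; exact: (v0 (i, s)).
  by rewrite ltW// FPdim_basis_gt0.
by exists u => // s Js; rewrite -foldr_gact; exact: Zu.
Qed.

Lemma Theta_face_word Z u : Theta Z -> all (fun s => Z (alpha s) == 0) u ->
  forall v, Z (gact G (coxeter_class M u) v) = Z v.
Proof.
move=> [ZD ZF]; elim: u => [_ v|s u IH /= /andP[/eqP Zs Zu] v]; first by rewrite act1.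
rewrite coxeter_class_cons actM gact_gen ZD cThetaN// ZF Zs mulr0 oppr0 addr0.
exact: IH.
Qed.

(** The given root need not be a [W]-translate of a simple root. After moving by [W], any simple
    root [b alpha_s] in its support is killed by both functionals, and positivity of the dimension
    of [b] passes this to [alpha_s]. *)
Lemma common_mirror Z1 Z2 v : Theta Z1 -> Theta Z2 -> neg_finite G Z1 ->
  neg_finite G Z2 -> croots G v -> Z1 v = 0 -> Z2 v = 0 ->
  exists w s, Z1 (gact G w (alpha s)) = 0 /\ Z2 (gact G w (alpha s)) = 0.
Proof.
move=> Z1T Z2T [r1 Z1r] Z2f rv Z1v Z2v.
have [u1 _ Z1d] := W_dominate predT Z1T Z1r.
set x := coxeter_class _ u1 in Z1d.
pose Y1 := Z1 \o gact G x; pose Y2 := Z2 \o gact G x.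
have Y1T : Theta Y1 by exact: Theta_gact.
have Y2T : Theta Y2 by exact: Theta_gact.
have [r2 Y2r] : neg_finite G Y2.
  have -> : Y2 = Z2 \o unfolded_action G (unfolding G x).
    by apply/funext => z; rewrite /Y2 /= unfolding_act.
  by apply: neg_finite_act => //; case: Z2T.
have [u2 Ju2 Y2d] := W_dominate (fun s => Y1 (alpha s) == 0) Y2T Y2r.
set y := coxeter_class _ u2 in Y2d.
have Y1y z : Y1 (gact G y z) = Y1 z by exact: Theta_face_word.
pose v' := gact G (x * y)^-1%g v.
have v'v : gact G x (gact G y v') = v by rewrite -!actM mulgV act1.
pose Y3 := Y2 \o gact G y.
have Y3T : Theta Y3 by exact: Theta_gact.
have Y1v' : Y1 v' = 0 by rewrite -Y1y /Y1 /= v'v.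
have Y3v' : Y3 v' = 0 by rewrite /Y3 /Y2 /= v'v.
have rv' : croots G v' by exact: croots_gact.
have [v'' [v''0 v''n Y1v'' Y3v'']] :
    exists v'', [/\ cpos v'', v'' != 0, Y1 v'' = 0 & Y3 v'' = 0].
  have [v'0|v'0] := croots_sign rv'.
    by exists v'; split => //; exact: croots_neq0 rv'.
  exists (- v'); rewrite oppr_eq0 !cThetaN; [|by case: Y3T|by case: Y1T].
  by rewrite Y1v' Y3v' oppr0; split => //; exact: croots_neq0 rv'.
have [a va] := cpos_coord_gt0 v''0 v''n.
have [||||_ /(_ a)[]] := @face_ge0 _ _ _ _ F Y1 Y3 v'' _ _ _ _ v''0 Y1v''.
- by case: Y1T.
- by case: Y3T.
- by apply: Theta_dominant => // s; exact: Z1d.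
- move=> c; rewrite !Theta_croot// => /eqP; rewrite mulf_eq0 gt_eqF ?FPdim_basis_gt0//=.
  by move=> Y1c; rewrite mulr_ge0 ?(ltW (FPdim_basis_gt0 _ _))//; exact: Y2d.
- by rewrite gt_eqF.
move=> Y1a /(_ Y3v'') Y3a; exists (x * y)%g, a.2; rewrite actM.
move: Y1a Y3a; rewrite !Theta_croot// => /eqP + /eqP.
rewrite !mulf_eq0 gt_eqF ?FPdim_basis_gt0//= => /eqP Y1a /eqP Y3a.
by split => //; rewrite -[LHS]/(Y1 (gact G y (alpha a.2))) Y1y.
Qed.

End RealisationDominance.

(** * Orbit spaces and monodromy *)

Section Pointwise.
Context {RR : realType} {V : choiceType}.
Local Notation D := {ptws V -> RR}.

Lemma ptws_eval_continuous (v : V) : continuous (fun Z : D => Z v).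
Proof. exact: (@proj_continuous V (fun=> RR) v). Qed.

Lemma ptws_cvg (H : set_system D) (Z : D) : Filter H ->
  (forall v : V, Y v @[Y --> H] --> Z v) -> H --> Z.
Proof.
move=> FH HZ; apply/cvg_sup => v; apply/cvg_image.
  by rewrite eqEsubset; split=> x // _; exists (cst x).
move=> B /= ZB; exists ((fun Y : D => Y v) @^-1` B); first exact: HZ.
by rewrite eqEsubset; split => [_ [Y By <-]//|x Bx]; exists (fun=> x).
Qed.

Lemma ptws_continuous (T : topologicalType) (f : T -> D) :
  (forall v, continuous (fun t => f t v)) -> continuous f.
Proof. by move=> cf t; apply: ptws_cvg => v; exact: cf. Qed.

End Pointwise.

Lemma dual_interiorI (RR : realType) (V : Type) (Theta E N : set {ptws V -> RR}) Z :
  Theta Z -> nbhs Z N -> (forall Y, N Y -> Theta Y -> E Y) -> dual_interior Theta E Z.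
Proof.
move=> ZT ZN NE; split=> //.
have sub : N `<=` [set Y | Theta Y -> E Y] by [].
exact: (filterS sub ZN).
Qed.

(** * Orbit maps and monodromy *)

Section OrbitSpace.
Local Open Scope quotient_scope.
Context {RR : realType} {S : finType} {M : coxeter_matrix S} {V : choiceType}.
Context (act : action (coxeter_group M) V) (alpha : S -> V).
Context (Theta : set {ptws V -> RR}).
Local Notation W := (coxeter_group M).
Local Notation D := {ptws V -> RR}.
Local Notation dual := (@dual_act RR S M V act).
Local Notation reg := (regular act alpha Theta).
Local Notation T0 := (tits_cone act alpha Theta).
Hypothesis Theta_dual : forall w Z, Theta Z -> Theta (dual w Z).

Lemma dual_actM w w' Z : dual (w * w')%g Z = dual w (dual w' Z).
Proof. by apply/funext => v; rewrite /dual_act invgM actM. Qed.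

Lemma dual_act1 Z : dual 1%g Z = Z.
Proof. by apply/funext => v; rewrite /dual_act invg1 act1. Qed.

Lemma dual_actK w : cancel (dual w) (dual w^-1%g).
Proof. by move=> Z; rewrite -dual_actM mulVg dual_act1. Qed.

Lemma dual_act_continuous w : continuous (dual w).
Proof. by apply: ptws_continuous => v; exact: ptws_eval_continuous. Qed.

Lemma diag_act_continuous w : continuous (@diag_act RR S M V act w).
Proof.
apply: continuous_pair.
  exact: comp_cts (@fst_cts _ _) (@dual_act_continuous w).
exact: comp_cts (@snd_cts _ _) (@dual_act_continuous w).
Qed.

Lemma tits_cone_act w Z : T0 Z -> T0 (dual w Z).
Proof.
move=> [ZT ZE].
pose E := [set Y | Theta Y ->
  (\bigcup_(u in [set: W]) dual u @` chamber alpha Theta) Y].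
have nE : nbhs (dual w^-1%g (dual w Z)) E by rewrite dual_actK; exact: ZE.
have nE' : nbhs (dual w Z) (dual w^-1%g @^-1` E) by exact: dual_act_continuous.
apply: (dual_interiorI (Theta_dual w ZT) nE') => Y YE YT.
have [u _ [Y' Y'C Y'Y]] := YE (Theta_dual w^-1%g YT).
exists (w * u)%g => //; exists Y' => //.
by rewrite dual_actM Y'Y -dual_actM mulgV dual_act1.
Qed.

Lemma regular_act w z : reg z -> reg (diag_act act w z).
Proof.
move=> [[z1 z2] zH]; split; first by split; exact: tits_cone_act.
(* A mirror through the translate pulls back along [w] to the mirror of the conjugate reflection. *)
move=> [_ [u [s ->]] [/= [zT1 zu1] [zT2 zu2]]]; apply: zH.
set g := (u * coxeter_gen M s * u^-1)%g in zu1 zu2.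
have conj : ((w^-1 * u) * coxeter_gen M s * (w^-1 * u)^-1 = w^-1 * g * w)%g.
  by rewrite invgM invgK !mulgA.
have fix_conj Z : dual g (dual w Z) = dual w Z -> dual (w^-1 * g * w)%g Z = Z.
  by move=> e; rewrite (dual_actM (w^-1 * g)) (dual_actM w^-1) e dual_actK.
exists (Theta `&` [set Z | dual (w^-1 * g * w)%g Z = Z]).
  by exists (w^-1 * u)%g, s; rewrite conj.
by split; split; [case: z1|exact: fix_conj|case: z2|exact: fix_conj].
Qed.

Definition regular_act_fun w (x : reg) : reg := point_in (regular_act w (set_valP x)).

Lemma regular_act1 x : regular_act_fun 1%g x = x.
Proof. by apply: val_inj; rewrite /= diag_act1. Qed.

Lemma regular_actM g h x :
  regular_act_fun (g * h)%g x = regular_act_fun g (regular_act_fun h x).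
Proof. by apply: val_inj; rewrite /= diag_actM. Qed.

Definition regular_action : action W reg := Action regular_act1 regular_actM.

Lemma val_regular_continuous : continuous (val : reg -> D * D).
Proof. by rewrite -set_valE; exact: (@initial_continuous reg (D * D)%type set_val). Qed.

Lemma regular_continuous (X : topologicalType) (f : X -> reg) :
  continuous (fun x => val (f x)) -> continuous f.
Proof.
by move=> cf; apply: (@continuous_comp_initial _ _ _ (set_val : reg -> (D * D)%type)).
Qed.

Lemma regular_action_continuous w : continuous (regular_action w).
Proof.
apply: regular_continuous.
exact: comp_cts val_regular_continuous (@diag_act_continuous w).
Qed.

Local Notation orb := (@orbit_of RR S M V act alpha Theta).

Lemma orbit_of_continuous : continuous orb.
Proof. exact: pi_continuous. Qed.

Lemma orbit_ofP x y : orb x = orb y <-> exists w, y = regular_action w x.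
Proof.
split=> [/eqmodP/asboolP[w xy]|[w ->]]; first by exists w; apply: val_inj.
by apply/eqmodP/asboolP; exists w.
Qed.

Lemma orbit_of_surj y : exists x, orb x = y.
Proof.
exists (repr (y : {eq_quot (same_orbit_equiv act alpha Theta)})).
by rewrite /orbit_of reprK.
Qed.

(** The saturation of [U] is the union of its translates. *)
Lemma orbit_of_open (U : set reg) : open U -> open (orb @` U).
Proof.
move=> oU; rewrite /open /= /quotient_open.
have -> : \pi_(quotient_topology {eq_quot same_orbit_equiv act alpha Theta})
    @^-1` (orb @` U) = \bigcup_w (regular_action w @^-1` U).
  apply/seteqP; split => [x [y Uy /esym/orbit_ofP[w yx]]|x [w _ Ux]].
    by exists w => //; rewrite /= -yx.
  by exists (regular_action w x) => //; apply/esym/orbit_ofP; exists w.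
apply: bigcup_open => w _; apply: open_comp => // x _.
exact: regular_action_continuous.
Qed.

Hypothesis wander :
  forall x : reg, exists2 U : set reg, open_nbhs x U & wandering regular_action U.

(** The set from which [monodromy] selects, named to separate existence from uniqueness. *)
Definition monodromy_spec (x : reg) (g : pi1 RR (orb x)) : set W :=
  [set w : W |
    exists (p : {path (unit_interval RR) from orb x to orb x})
           (y : reg) (q : {path (unit_interval RR) from x to y}),
      [/\ loop_class p = g, forall t, orb (q t) = p t &
          val y = diag_act act w (val x)]].

Lemma monodromy_spec_exists (x : reg) (g : pi1 RR (orb x)) :
  exists w, monodromy_spec g w.
Proof.
pose p := loop_repr g.
have [|q cq [q0 qp]] := @path_lifting RR W reg _ regular_action orb
  regular_action_continuous orbit_ofP orbit_of_surj orbit_of_open wander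
  (extp p) x (@extp_continuous _ _ _ _ p).
  by rewrite extp_le0.
have c' : continuous (q \o val : unit_interval RR -> reg).
  exact: comp_cts (@val_continuous RR) cq.
pose q' : {path (unit_interval RR) from x to q 1} := mk_path c' q0 erefl.
have [w xw] : exists w, q 1 = regular_action w x.
  by apply/orbit_ofP; rewrite qp ?ler01 ?lexx// extp_ge1.
exists w, p, (q 1), q'; split; first exact: loop_reprK.
  move=> t; rewrite -[RHS]extp_val -qp//.
  by case: t => t /=; rewrite inE /= in_itv.
by rewrite xw.
Qed.

(** Two representing loops are homotopic, and the lifted stages of the homotopy share their end
    point. Only end points are compared here; freeness later turns this into equality of group
    elements. *)
Lemma monodromy_spec_unique (x : reg) (g : pi1 RR (orb x)) w w' :
  monodromy_spec g w -> monodromy_spec g w' ->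
  diag_act act w (val x) = diag_act act w' (val x).
Proof.
move=> [p [y [q [pg qp <-]]]] [p' [y' [q' [p'g qp' <-]]]]; congr val.
have /homotopicP[K [cK K0 K1 Kx Ky]] : homotopic p p'.
  by apply/loop_classP; rewrite pg p'g.
(* Clamping the time yields lifts over the whole line, although [path_lifting] controls the
   projection on the unit interval only. *)
pose K' (z : RR * RR) := K (z.1, val (clamp z.2)).
have cK' : continuous K'.
  apply: comp_cts cK; apply: continuous_pair; first exact: fst_cts.
  apply: comp_cts (@val_continuous RR).
  exact: comp_cts (@snd_cts _ _) (@clamp_continuous RR).
have lift s : exists L : RR -> reg,
    [/\ continuous L, L 0 = x & forall t, orb (L t) = K' (s, t)].
  have cKs : continuous (fun t => K' (s, t)).
    apply: comp_cts cK'; apply: continuous_pair; first exact: cst_continuous.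
    by move=> t; exact: cvg_id.
  have [|L cL [L0 LP]] := @path_lifting RR W reg _ regular_action orb
    regular_action_continuous orbit_ofP orbit_of_surj orbit_of_open wander _ x cKs.
    by rewrite /K' clamp_le0//= Kx.
  exists (fun t => L (val (clamp t))); split.
  - exact: (comp_cts (@clamp_continuous RR) (comp_cts (@val_continuous RR) cL)).
  - by rewrite clamp_le0.
  - move=> t; rewrite LP; last by case: (clamp t) => /= u; rewrite inE /= in_itv.
    by rewrite /K' clamp_val.
(* The lifts are chosen independently for each [s]; [homotopy_lift_end] supplies the continuity in
   [s]. *)
have [L LP] := choice lift.
have end_eq : L 0 1 = L 1 1.
  apply: (@homotopy_lift_end RR W reg _ regular_action orb
    regular_action_continuous orbit_ofP orbit_of_open wander K' L) => //.
  - by move=> s; have [] := LP s.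
  - by move=> s t; have [_ _ ->] := LP s.
  - by move=> s s'; have [_ -> _] := LP s; have [_ -> _] := LP s'.
  - by move=> s s'; rewrite /K' clamp_ge1//= !Ky.
have uniq s z (r : {path (unit_interval RR) from x to z}) :
    (forall t, orb (r t) = K (s, val t)) -> L s 1 = z.
  move=> rK; rewrite -(extp_ge1 r (lexx 1)).
  have [cL L0 LK] := LP s.
  apply: (@lift_unique RR W reg _ regular_action orb
    regular_action_continuous orbit_ofP wander (L s) (extp r) cL
    (@extp_continuous _ _ _ _ r) _ 0).
    by move=> t; rewrite LK /extp rK.
  by rewrite extp_le0.
rewrite -(uniq 0 y q) -?(uniq 1 y' q')// => t.
- by rewrite qp' K1 extp_val.
- by rewrite qp K0 extp_val.
Qed.

End OrbitSpace.

(** * The unfolded complement *)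

Lemma separated_nbhs (RR : realType) (T : topologicalType) (h : T -> RR) x y :
  continuous h -> h x != h y ->
  exists A B : set T, [/\ nbhs x A, nbhs y B & forall z, A z -> B z -> False].
Proof.
move=> ch hxy; pose e := `|h x - h y| / 2.
have e0 : 0 < e by rewrite divr_gt0// normr_gt0 subr_eq0.
have near_e z : nbhs z [set t | `|h z - h t| < e].
  by have /cvgrPdist_lt/(_ e e0) := ch z.
exists [set t | `|h x - h t| < e], [set t | `|h y - h t| < e]; split => // z /= xz yz.
have : `|h x - h y| <= `|h x - h z| + `|h y - h z|.
  by rewrite (distrC (h y)); exact: ler_distD.
rewrite leNgt => /negP; apply.
by rewrite [ltRHS]splitr ltrD.
Qed.

Section HatComplement.
Context {RR : realType} {S : finType} {M : coxeter_matrix S} {R : nzRingType}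
  {n : nat} {F : fusion_ring R n} (G : geometric_realisation RR M F).
Local Notation A := ('I_n.+1 * S)%type.
Local Notation V := (root_module S R).
Local Notation D := {ptws V -> RR}.
Local Notation cW := (coxeter_group (unfolded_matrix G)).
Local Notation cgen := (coxeter_gen (unfolded_matrix G)).
Local Notation croot := (@croot S R n F).
Local Notation cTheta := (@cTheta RR S R).
Local Notation cOmega := (cOmega_reg G).
Local Notation cT := (tits_cone (unfolded_action G) croot cTheta).
Local Notation rho := (@weyl_vector RR S R n F).
Local Notation "w • v" := (unfolded_action G w v) (at level 40).
Local Notation dual := (dual_act (unfolded_action G)).
Implicit Types (Z Y : D).

Definition weyl_shift (e : RR) Z : D := fun v => Z v - e * rho v.

Lemma rho_cTheta : cTheta rho.
Proof. by case: (@weyl_vector_Theta RR S R n F). Qed.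

Lemma weyl_shift_cTheta e Z : cTheta Z -> cTheta (weyl_shift e Z).
Proof.
by move=> ZD u v; rewrite /weyl_shift ZD rho_cTheta mulrDr opprD addrACA.
Qed.

(** The line through [Z] in the direction of [rho] is continuous in [e] and stays in [Theta], so it
    remains in [E] for small [e]. *)
Lemma weyl_shift_interior (Theta E : set D) Z : (forall e, Theta (weyl_shift e Z)) ->
  dual_interior Theta E Z -> exists2 e, 0 < e & E (weyl_shift e Z).
Proof.
move=> ZT [_ ZE].
have cs : continuous (weyl_shift ^~ Z).
  apply: ptws_continuous => v t; apply: cvgB; first exact: cvg_cst.
  by apply: cvgM; [exact: cvg_id|exact: cvg_cst].
have s0 : weyl_shift 0 Z = Z by apply/funext => v; rewrite /weyl_shift mul0r subr0.
have nE : nbhs (weyl_shift 0 Z) [set Y | Theta Y -> E Y] by rewrite s0; exact: ZE.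
have [d /= d0 dE] := cs 0 _ nE.
exists (d / 2); first by rewrite divr_gt0.
apply: dE => //=; rewrite /ball_/= sub0r normrN gtr0_norm ?divr_gt0//.
by rewrite ltr_pdivrMr// ltr_pMr// ltr1n.
Qed.

Lemma cTheta_dual w Z : cTheta Z -> cTheta (dual w Z).
Proof. exact: cTheta_act. Qed.

Lemma hat_orbit_neg_finite Z :
  (\bigcup_(w in [set: cW]) dual w @` chamber croot cTheta) Z ->
  cTheta Z /\ neg_finite G Z.
Proof.
move=> [w _ [Y [YD Yd] <-]]; split; first exact: cTheta_dual.
by apply: neg_finite_act => //; exact: dominant_neg_finite.
Qed.

Lemma neg_finite_hat_orbit Z : cTheta Z -> neg_finite G Z ->
  (\bigcup_(w in [set: cW]) dual w @` chamber croot cTheta) Z.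
Proof.
move=> ZD [r Zr]; have [u [_ _ Zu]] := cW_dominate predT ZD Zr.
set w := coxeter_class _ u in Zu; exists w => //.
exists (Z \o unfolded_action G w).
  by split; [exact: cTheta_act|move=> a; exact: Zu].
by apply/funext => v; rewrite /dual_act /= cactVK.
Qed.

Lemma weyl_shift_near e Z : 0 < e ->
  \forall Y \near Z, forall a : A, weyl_shift e Z (croot a) < Y (croot a).
Proof.
move=> e0; apply: (@filter_forall D A
  (fun a Y => weyl_shift e Z (croot a) < Y (croot a)) (nbhs Z)) => a.
have nB : nbhs (Z (croot a)) [set y | weyl_shift e Z (croot a) < y].
  apply: open_nbhs_nbhs; split; first exact: open_gt.
  by rewrite /= /weyl_shift gtrBl mulr_gt0// weyl_vector_dominant.
exact: (ptws_eval_continuous nB).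
Qed.

(** Conversely, the functionals exceeding the shift on all simple roots form a neighbourhood of [Z],
    and [neg_finite] is inherited by larger values on simple roots. *)
Lemma hat_tits_coneP Z :
  cT Z <-> cTheta Z /\ exists2 e, 0 < e & neg_finite G (weyl_shift e Z).
Proof.
split=> [ZT|[ZD [e e0 Zf]]].
  have ZD : cTheta Z by case: ZT.
  split=> //.
  have [e e0 ZE] := weyl_shift_interior (fun e => weyl_shift_cTheta e ZD) ZT.
  by exists e => //; case: (hat_orbit_neg_finite ZE).
apply: (dual_interiorI ZD (weyl_shift_near Z e0)) => Y YZ YD.
apply: neg_finite_hat_orbit => //.
by apply: neg_finite_le Zf => // [|a]; [exact: weyl_shift_cTheta|exact/ltW/YZ].
Qed.

Lemma hat_tits_cone_neg_finite Z : cT Z -> neg_finite G Z.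
Proof.
move=> /hat_tits_coneP[ZD [e e0 Zf]]; apply: neg_finite_le Zf => //.
  exact: weyl_shift_cTheta.
by move=> a; rewrite gerBl mulr_ge0 ?ltW// weyl_vector_dominant.
Qed.

Lemma hat_reflection_fixed w a Z : cTheta Z ->
  dual (w * cgen a * w^-1)%g Z = Z <-> Z (w • croot a) = 0.
Proof.
move=> ZD; have gV : ((w * cgen a * w^-1)^-1 = w * cgen a * w^-1)%g.
  by rewrite !invgM invgK coxeter_genV mulgA.
split=> [/(congr1 (fun Y : D => Y (w • croot a)))|Za].
  rewrite /dual_act gV !actM cactK cact_gen_root cactN cThetaN// => /eqP.
  by rewrite eq_sym -addr_eq0 -mulr2n mulrn_eq0 => /eqP.
apply/funext => v; rewrite /dual_act gV !actM cact_gen /crefl cactD cactN cactVK.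
set k := cbilin _ _ _; rewrite ZD cThetaN// cactMz.
suff -> : Z ((w • croot a) *~ k) = 0 by rewrite oppr0 addr0.
pose z : {additive V -> RR} :=
  HB.pack Z (GRing.isNmodMorphism.Build V RR Z (cTheta_nmod ZD)).
by rewrite -[Z]/(z : V -> RR) raddfMz /= Za mul0rz.
Qed.

Lemma hat_free z w : cOmega z -> diag_act (unfolded_action G) w z = z -> w = 1%g.
Proof.
move=> [[/= T1 T2] zH] wz.
have Z1D : cTheta z.1 by case: T1.
have Z2D : cTheta z.2 by case: T2.
have wz1 : dual w z.1 = z.1 by rewrite -[RHS](congr1 fst wz).
have wz2 : dual w z.2 = z.2 by rewrite -[RHS](congr1 snd wz).
suff wV1 : (w^-1 = 1)%g by rewrite -[w]invgK wV1 invg1.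
apply: (common_stabiliser Z1D Z2D).
- exact: hat_tits_cone_neg_finite.
- exact: hat_tits_cone_neg_finite.
- by move=> v; rewrite -[in RHS]wz1.
- by move=> v; rewrite -[in RHS]wz2.
move=> _ [u [a ->]] z1 z2; apply: zH.
exists (cTheta `&` [set Z | dual (u * cgen a * u^-1)%g Z = Z]); first by exists u, a.
by split; split => //; apply/hat_reflection_fixed.
Qed.

Fixpoint words (k : nat) : seq (seq A) :=
  if k is k'.+1 then [::] :: [seq a :: u | a <- enum {: A}, u <- words k']
  else [:: [::]].

Lemma mem_words k u : (size u <= k)%N -> u \in words k.
Proof.
elim: k u => [|k IH] [|a u] //= uk; rewrite inE; apply/orP; right.
by apply: allpairs_f; [rewrite mem_enum|exact: IH].
Qed.

Local Notation hact := (regular_action croot cTheta_dual).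

(* Near [x] all but finitely many positive roots are positive on the first
   component, which bounds the inversions, hence the length, of an element that
   maps a point of this neighbourhood into it; the finitely many remaining
   elements are handled by separation. *)
Lemma hat_wander (x : cOmega) :
  exists2 U : set cOmega, open_nbhs x U & wandering hact U.
Proof.
have [[/= T1 T2] xH] := set_valP x.
have [Z1D [e e0 [r Zr]]] := (hat_tits_coneP _).1 T1.
pose U1 := [set z : cOmega | forall a : A,
  weyl_shift e (val x).1 (croot a) < (val z).1 (croot a)].
have nU1 : nbhs x U1.
  have c1 : continuous (fun z : cOmega => (val z).1).
    exact: comp_cts (@val_regular_continuous _ _ _ _ _ _ _) (@fst_cts _ _).
  exact: (c1 x _ (weyl_shift_near _ e0)).
have U1pos (z : cOmega) v : U1 z -> croots G v -> cpos (F := F) v ->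
    v \notin r -> 0 < (val z).1 v.
  move=> Uz rv v0 vr.
  have [[/= [zD _] _] _] := set_valP z.
  have sD := weyl_shift_cTheta e Z1D.
  have s0 : 0 <= weyl_shift e (val x).1 v.
    by rewrite leNgt; apply/negP => vneg; move: vr; rewrite (Zr v rv v0 vneg).
  apply: le_lt_trans s0 _; rewrite -subr_gt0.
  pose Y : D := fun v => (val z).1 v - weyl_shift e (val x).1 v.
  have YD : cTheta Y by move=> p q; rewrite /Y zD sD opprD addrACA.
  apply: (strictly_dominant_gt0 YD _ v0 (croots_neq0 rv)) => a.
  by rewrite subr_gt0.
(* An inversion [v] of [w^-1] outside [r] is positive at [w z]; then [- (w^-1 • v)] is a positive
   root negative at [z], hence in [r]. This accounts for the second copy of [r]. *)
pose K := (size r + size r)%N.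
have U1words w z : U1 z -> U1 (hact w z) ->
    exists2 u, u \in words K & w = coxeter_class _ u.
  move=> Uz Uwz.
  have [|u uK wu] := inversions_word (w := w^-1%g)
      (r := r ++ map (fun v => - (w • v)) r) rho_cTheta (@weyl_vector_dominant RR S R n F).
    move=> v rv v0 nv; rewrite mem_cat.
    have rwv : croots G (w^-1%g • v) by exact: cact_croots.
    have [//|nwv] := croots_sign rwv.
    have [//|vr] := boolP (v \in r).
    have := U1pos _ v Uwz rv v0 vr; rewrite /= /dual_act => wv_gt0.
    set v' := - (w^-1%g • v) in nwv.
    have v'r : v' \in r.
      apply/negPn/negP => nr.
      have := U1pos _ v' Uz (croots_opp rwv) nwv nr.
      have [[/= [zD _] _] _] := set_valP z.
      by rewrite cThetaN// oppr_gt0 ltNge ltW.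
    apply/mapP; exists v' => //.
    by rewrite /v' cactN cactVK opprK.
  exists (rev u).
    by apply: mem_words; rewrite size_rev; move: uK; rewrite size_cat size_map.
  apply: invg_inj; rewrite wu; apply: (mulIg (coxeter_class _ (rev u))).
  rewrite mulVg -coxeter_class_cat.
  by apply/coxeter_classP; rewrite -{1}[u]revK; exact: coxeter_cong_rev.
(* Each listed element either fixes [x] or moves a neighbourhood of [x] off itself, by a coordinate
   of one component; finitely many neighbourhoods are intersected. *)
have sep (l : seq (seq A)) : exists2 U, nbhs x U & forall u, u \in l ->
    hact (coxeter_class _ u) x = x \/
    forall z, U z -> U (hact (coxeter_class _ u) z) -> False.
  elim: l => [|u l [U nU Ul]]; first by exists setT; [exact: filterT|].
  have [ux|/eqP ux] := eqVneq (hact (coxeter_class _ u) x) x.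
    by exists U => // v; rewrite inE => /orP[/eqP->|/Ul//]; left.
  set w := coxeter_class _ u in ux.
  have [A' [B' [nA nB AB]]] : exists A' B' : set cOmega,
      [/\ nbhs x A', nbhs (hact w x) B' & forall z, A' z -> B' z -> False].
    have cval := @val_regular_continuous RR A (unfolded_matrix G) V
      (unfolded_action G) croot cTheta.
    have [e1|/eqP e1] := pselect ((val (hact w x)).1 = (val x).1).
      have e2 : (val (hact w x)).2 <> (val x).2.
        move=> e2; apply: ux; apply: val_inj.
        by rewrite [LHS]surjective_pairing [RHS]surjective_pairing e1 e2.
      have [v xv] : exists v, (val x).2 v <> (val (hact w x)).2 v.
        by apply/existsNP => h; apply: e2; apply/esym/funext.
      apply: (@separated_nbhs RR cOmega (fun z => (val z).2 v)); last exact/eqP.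
      exact: comp_cts (comp_cts cval (@snd_cts _ _)) (@ptws_eval_continuous RR V v).
    have [v xv] : exists v, (val x).1 v <> (val (hact w x)).1 v.
      by apply/existsNP => h; move/eqP: e1; apply; apply/esym/funext.
    apply: (@separated_nbhs RR cOmega (fun z => (val z).1 v)); last exact/eqP.
    exact: comp_cts (comp_cts cval (@fst_cts _ _)) (@ptws_eval_continuous RR V v).
  exists (U `&` (A' `&` hact w @^-1` B')).
    apply: filterI => //; apply: filterI => //.
    exact: (regular_action_continuous (x := x) nB).
  move=> v; rewrite inE => /orP[/eqP->|vl].
    by right => z [_ [_ Bz]] [_ [Az _]]; exact: AB Az Bz.
  have [|Uv] := Ul v vl; first by left.
  by right => z [Uz _] [Uz' _]; exact: Uv Uz Uz'.
have [U2 nU2 U2P] := sep (words K).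
have : nbhs x (U1 `&` U2) by exact: filterI.
rewrite nbhsE => -[U oU UU]; exists U => // w z Uz Uwz.
have [[Uz1 Uz2] [Uwz1 Uwz2]] := (UU _ Uz, UU _ Uwz).
have [u uK wu] := U1words _ _ Uz1 Uwz1.
have wx : hact w x = x.
  by rewrite wu; have [//|] := U2P u uK; move=> /(_ z Uz2); rewrite -wu => /(_ Uwz2).
(* An element that is not separated fixes [x], and the action is free. *)
have -> : w = 1%g by apply: (hat_free (set_valP x)); rewrite -[RHS](congr1 val wx).
by move=> y; rewrite act1.
Qed.

End HatComplement.

Arguments weyl_shift {RR S R n} F e Z.
Arguments hat_wander {RR S M R n F} G x.

(** * The inclusion of complements *)

Section Inclusion.
Context {RR : realType} {S : finType} {M : coxeter_matrix S} {R : nzRingType}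
  {n : nat} {F : fusion_ring R n} (G : geometric_realisation RR M F).
Local Notation V := (root_module S R).
Local Notation D := {ptws V -> RR}.
Local Notation W := (coxeter_group M).
Local Notation gen := (coxeter_gen M).
Local Notation croot := (@croot S R n F).
Local Notation cTheta := (@cTheta RR S R).
Local Notation Theta := (@Theta RR S R n F).
Local Notation alpha := (simple_root R).
Local Notation Omega := (Omega_reg G).
Local Notation cOmega := (cOmega_reg G).
Local Notation T0 := (tits_cone (gact G) alpha Theta).
Local Notation cT := (tits_cone (unfolded_action G) croot cTheta).
Local Notation dual := (dual_act (gact G)).
Implicit Types (Z Y : D).

Lemma Theta_dual w Z : Theta Z -> Theta (dual w Z).
Proof. exact: Theta_gact. Qed.

Lemma unfoldingV w : unfolding G w^-1%g = (unfolding G w)^-1%g.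
Proof.
have [f1 fM] := unfolding_morphism G.
by apply: (mulgI (unfolding G w)); rewrite -fM !mulgV f1.
Qed.

Lemma dual_act_unfolding w Z :
  dual_act (unfolded_action G) (unfolding G w) Z = dual w Z.
Proof. by apply/funext => v; rewrite /dual_act -unfoldingV unfolding_act. Qed.

Lemma diag_act_unfolding w (z : D * D) :
  diag_act (unfolded_action G) (unfolding G w) z = diag_act (gact G) w z.
Proof. by rewrite /diag_act !dual_act_unfolding. Qed.

Lemma orbit_neg_finite Z :
  (\bigcup_(w in [set: W]) dual w @` chamber alpha Theta) Z -> neg_finite G Z.
Proof.
move=> [w _ [Y [YT Yd] <-]]; rewrite -dual_act_unfolding; apply: neg_finite_act.
  by case: YT.
apply: dominant_neg_finite; first by case: YT.
exact: Theta_dominant.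
Qed.

Lemma weyl_shift_Theta e Z : Theta Z -> Theta (weyl_shift F e Z).
Proof.
move=> [ZD ZF]; split; first exact: weyl_shift_cTheta.
move=> r v; have [_ rhoF] := @weyl_vector_Theta RR S R n F.
by rewrite /weyl_shift ZF rhoF mulrBr mulrCA.
Qed.

(** Since [rho] lies in [Theta], the shift that tests the interior for [W] also tests it for the
    unfolded group. *)
Lemma tits_cone_sub : T0 `<=` cT.
Proof.
move=> Z ZT; have ZTh : Theta Z by case: ZT.
apply/hat_tits_coneP; split; first by case: ZTh.
have [e e0 ZE] := weyl_shift_interior (fun e => weyl_shift_Theta e ZTh) ZT.
by exists e => //; exact: orbit_neg_finite.
Qed.

Lemma gen_conjV w s : ((w * gen s * w^-1)^-1 = w * gen s * w^-1)%g.
Proof. by rewrite !invgM invgK coxeter_genV mulgA. Qed.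

Lemma gactN w v : gact G w (- v) = - gact G w v.
Proof. by rewrite -scaleN1r gactZ scaleN1r. Qed.

Lemma reflection_fixed w s Z : Theta Z ->
  dual (w * gen s * w^-1)%g Z = Z <-> Z (gact G w (alpha s)) = 0.
Proof.
move=> [ZD ZF].
have gK v : gact G w^-1%g (gact G w v) = v by rewrite -actM mulVg act1.
have gVK v : gact G w (gact G w^-1%g v) = v by rewrite -actM mulgV act1.
split=> [/(congr1 (fun Y : D => Y (gact G w (alpha s))))|Zs].
  rewrite /dual_act gen_conjV !actM gK gact_gen_root gactN cThetaN// => /eqP.
  by rewrite eq_sym -addr_eq0 -mulr2n mulrn_eq0 => /eqP.
apply/funext => v; rewrite /dual_act gen_conjV !actM gact_gen gactD gactN gVK gactZ.
by rewrite ZD cThetaN// ZF Zs mulr0 oppr0 addr0.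
Qed.

(** A mirror of the unfolded group containing both components yields, by [common_mirror], a mirror
    of [W] containing both. *)
Lemma Omega_sub : Omega `<=` cOmega.
Proof.
move=> [Z1 Z2] [[/= T1 T2] zH].
have cT1 := tits_cone_sub T1; have cT2 := tits_cone_sub T2.
split=> // -[_ [w [a ->]] [/= [Z1D fix1] [Z2D fix2]]]; apply: zH.
have Z1T : Theta Z1 by case: T1.
have Z2T : Theta Z2 by case: T2.
have [||||u [s [Z1s Z2s]]] := @common_mirror _ _ _ _ _ _ G Z1 Z2 _ Z1T Z2T _ _
    (cact_croots w (croots_root G a)).
- exact: hat_tits_cone_neg_finite.
- exact: hat_tits_cone_neg_finite.
- exact/hat_reflection_fixed.
- exact/hat_reflection_fixed.
exists (Theta `&` [set Z | dual (u * gen s * u^-1)%g Z = Z]); first by exists u, s.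
by split; split => //; apply/reflection_fixed.
Qed.

(** Some shift of [Z] by a positive multiple of [rho] is still in the closed chamber, and [rho] is 1
    on [alpha s]. *)
Lemma open_chamber_pos Z s : open_chamber alpha Theta Z -> 0 < Z (alpha s).
Proof.
move=> ZC; have ZTh : Theta Z by case: ZC.
have [e e0 [_ /(_ s)]] := weyl_shift_interior (fun e => weyl_shift_Theta e ZTh) ZC.
by rewrite /weyl_shift weyl_vector_root mulr1 subr_ge0; exact: lt_le_trans.
Qed.

(** This provides the base point: every root is positive or negative, so a strictly dominant
    functional vanishes on none. *)
Lemma open_chamber_regular Z : open_chamber alpha Theta Z -> Omega (Z, Z).
Proof.
move=> ZC; have ZTh : Theta Z by case: ZC.
have ZT : T0 Z.
  case: (ZC) => _ ZN; apply: (dual_interiorI ZTh ZN) => Y YC YT.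
  by exists 1%g => //; exists Y; [exact: YC|exact: dual_act1].
split=> // -[_ [w [s ->]] [/= [_ /(reflection_fixed _ _ ZTh) Zs] _]].
have ZD : cTheta Z by case: ZTh.
have rv : croots G (gact G w (alpha s)).
  by apply: croots_gact; rewrite (simple_root_croot (F := F)); exact: croots_root.
have Zpos := Theta_strictly_dominant ZTh (fun s => open_chamber_pos s ZC).
have [v0|v0] := croots_sign rv.
  by have := strictly_dominant_gt0 ZD Zpos v0 (croots_neq0 rv); rewrite Zs ?ltxx.
have := strictly_dominant_gt0 ZD Zpos v0.
by rewrite oppr_eq0 cThetaN// Zs// oppr0 ltxx => /(_ (croots_neq0 rv)).
Qed.

(** * Equivariance and monodromy of the inclusion *)

Local Notation wact := (regular_action alpha Theta_dual).
Local Notation hact := (regular_action croot (@cTheta_dual _ _ _ _ _ _ G)).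
Local Notation incl := (inclusion Omega_sub).

Lemma inclusion_act w x : incl (wact w x) = hact (unfolding G w) (incl x).
Proof. by apply: val_inj; rewrite [RHS]diag_act_unfolding. Qed.

Lemma inclusion_continuous : continuous incl.
Proof.
apply: regular_continuous.
exact: (@val_regular_continuous RR S M V (gact G) alpha Theta).
Qed.

Lemma inclusion_inj : injective incl.
Proof. by move=> x y /(congr1 val) /= e; apply: val_inj. Qed.

(** Wandering neighbourhoods pull back along the inclusion, which is injective, continuous and
    equivariant for [unfolding]. *)
Lemma Omega_wander (x : Omega) :
  exists2 U : set Omega, open_nbhs x U & wandering wact U.
Proof.
have [U [oU Ux] wU] := hat_wander G (incl x).
exists (incl @^-1` U).
  by split => //; apply: open_comp => // y _; exact: inclusion_continuous.
move=> w z /= Uz; rewrite inclusion_act => Uwz e; apply: inclusion_inj.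
by rewrite inclusion_act; exact: wU Uz Uwz _.
Qed.

Local Open Scope quotient_scope.

(** The image is taken on a chosen representative; equivariance makes the choice immaterial. *)
Definition orbit_inclusion (y : orbit_space (gact G) alpha Theta) :
    orbit_space (unfolded_action G) croot cTheta :=
  orbit_of (incl (repr (y : {eq_quot same_orbit_equiv (gact G) alpha Theta}))).

Lemma orbit_inclusionE x : orbit_inclusion (orbit_of x) = orbit_of (incl x).
Proof.
rewrite /orbit_inclusion; set z := repr _.
have /(orbit_ofP Theta_dual)[w ->] : orbit_of x = orbit_of z.
  by rewrite [RHS]/orbit_of /z reprK.
apply/esym/(orbit_ofP (@cTheta_dual _ _ _ _ _ _ G)).
by exists (unfolding G w); rewrite inclusion_act.
Qed.

Lemma orbit_inclusion_continuous : continuous orbit_inclusion.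
Proof.
apply/quotient_continuous.
have -> : orbit_inclusion \o
    \pi_(quotient_topology {eq_quot same_orbit_equiv (gact G) alpha Theta}) =
    fun x => orbit_of (incl x).
  by apply/funext => x; exact: orbit_inclusionE.
exact: comp_cts inclusion_continuous (@orbit_of_continuous _ _ _ _ _ _ _).
Qed.

Lemma monodromy_inclusion (x : Omega)
    (f : continuousType (orbit_space (gact G) alpha Theta)
           (orbit_space (unfolded_action G) croot cTheta))
    (fE : forall x : Omega, f (orbit_of x) = orbit_of (incl x))
    (g : pi1 RR (orbit_of x)) :
  monodromy (incl x) (pi1_map (fE x) g) = unfolding G (monodromy x g).
Proof.
(* Existence of lifts rules out the default value of [monodromy]. *)
have : monodromy_spec g (monodromy x g).
  apply: xgetPex; exact: (monodromy_spec_exists Omega_wander).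
set m := monodromy x g => -[p [y [q [pg qp ym]]]].
have spec : monodromy_spec (x := incl x) (pi1_map (fE x) g) (unfolding G m).
  have cq : continuous (incl \o q).
    by apply: comp_cts inclusion_continuous; exact: cts_fun.
  have q0 : (incl \o q) zero = incl x by rewrite /= path_zero.
  have q1 : (incl \o q) one = incl y by rewrite /= path_one.
  exists (map_loop (fE x) p), (incl y), (mk_path cq q0 q1); split.
  - by rewrite -pg pi1_map_class.
  - by move=> t; rewrite -[RHS]/(f (p t)) -qp fE.
  - by rewrite [LHS]ym diag_act_unfolding.
(* Any other admissible element moves the base point to the same end point, and freeness identifies
   the two. *)
apply: xget_unique => // w wspec.
have := monodromy_spec_unique (hat_wander G) spec wspec.
move=> /(congr1 (diag_act (unfolded_action G) (unfolding G m)^-1%g)).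
rewrite -!diag_actM mulVg diag_act1 => /esym/(hat_free (set_valP (incl x))) e.
by apply: (mulgI (unfolding G m)^-1%g); rewrite e mulVg.
Qed.

End Inclusion.

Theorem theorem1p2 (RR : realType) (S : finType) (M : coxeter_matrix S)
    (R : nzRingType) (n : nat) (F : fusion_ring R n)
    (G : geometric_realisation RR M F)
    (x0 : {ptws (root_module S R) -> RR})
    (x0_in : open_chamber (simple_root R) (Theta F) x0) :
  [/\ monoid.monoid_morphism (unfolding G),
      forall s : S, unfolding G (coxeter_gen M s) =
        (\prod_(i < n.+1) coxeter_gen (unfolded_matrix G) (i, s))%g
    & exists (base : Omega_reg G (x0, x0))
             (sub : Omega_reg G `<=` cOmega_reg G)
             (f : continuousType
                (orbit_space (gact G) (simple_root R) (Theta F))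
                (orbit_space (unfolded_action G) (croot (F := F)) cTheta))
             (fE : forall x : Omega_reg G,
                f (orbit_of x) = orbit_of (inclusion sub x)),
        forall g : pi1 RR (orbit_of (point_in base)),
          monodromy (inclusion sub (point_in base)) (pi1_map (fE _) g)
          = unfolding G (monodromy (point_in base) g)].
Proof.
split; [exact: unfolding_morphism|exact: unfolding_gen|].
pose f : continuousType (orbit_space (gact G) (simple_root R) (Theta F))
    (orbit_space (unfolded_action G) (croot (F := F)) cTheta) :=
  HB.pack (orbit_inclusion (G := G))
    (isContinuous.Build _ _ _ (@orbit_inclusion_continuous _ _ _ _ _ _ G)).
exists (open_chamber_regular G x0_in), (@Omega_sub _ _ _ _ _ _ G), f.
exists (@orbit_inclusionE _ _ _ _ _ _ G) => g.
exact: monodromy_inclusion.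
Qed.
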